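(* Let $(u,v,w)$ be a triple of weights with $u^{-1}, vw^2\in L^1_{\mathrm{loc}}(\mathbb{R})$. Assume that $w$ is a dyadic doubling weight and that there are constants $C_1,C_2>0$ such that $$Q_J(u,v,w)\le C_1\langle u^{-1}\rangle_J\quad\text{and}\quad R_J(u,v,w)\le C_2\langle vw^2\rangle_J\qquad\text{for all } J\in\mathcal{D}.$$ Then the Haar multipliers $T_{w,\sigma}$ are bounded from $L^2(u)$ into $L^2(v)$ uniformly in the choice of signs $\sigma$ if and only if the following three conditions hold simultaneously: (i) $S_w^d$ is bounded from $L^2(uw^2)$ into $L^2(vw^2)$; (ii) $S_w^d$ is bounded from $L^2(v^{-1})$ into $L^2(u^{-1})$; (iii) the positive operator $P_{w,\lambda}$ is bounded from $L^2(u)$ into $L^2(v)$, where $$P_{w,\lambda}f(x):=\sum_{I\in\mathcal{D}}\frac{w(x)}{|I|}\,\lambda_I\,\langle f\rangle_I\,\mathbf{1}_I(x),\qquad \lambda_I=\frac{|\Delta_I(u^{-1})|}{\langle u^{-1}\rangle_I}\,\frac{|\Delta_I(vw^2)|}{\langle vw^2\rangle_I}\,\frac{|I|}{\langle w\rangle_I}.$$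
   Context: A weight is an almost everywhere positive, locally integrable function on $\mathbb{R}$. $\mathcal{D}$ is the family of dyadic intervals $[k2^{-j},(k+1)2^{-j})$, $k,j\in\mathbb{Z}$; for $J\in\mathcal{D}$, $\mathcal{D}(J)=\{I\in\mathcal{D}: I\subset J\}$. For $I\in\mathcal{D}$, $I^+$ and $I^-$ are its right and left halves and $\widetilde I\in\mathcal D$ is its dyadic parent. $|I|$ is the length of $I$; $\omega(I)=\int_I\omega(x)\,dx$; $\langle g\rangle_I=\frac1{|I|}\int_I g(x)\,dx$; $\langle f\rangle_I^w=\frac{1}{w(I)}\int_I f(x)w(x)\,dx$; $\Delta_I g=\langle g\rangle_{I^+}-\langle g\rangle_{I^-}$. $L^2(u)$ denotes $L^2(\mathbb{R},u\,dx)$. The weight $w$ is dyadic doubling if $\sup_{I\in\mathcal{D}}w(\widetilde I)/w(I)<\infty$. The Haar functions are $h_I=|I|^{-1/2}(\mathbf{1}_{I^+}-\mathbf{1}_{I^-})$, and $\langle f,g\rangle=\int_{\mathbb{R}}f(x)g(x)\,dx$. For a sequence of signs $\sigma=\{\sigma_I\}_{I\in\mathcal{D}}$, $\sigma_I=\pm1$, the signed Haar multiplier is (formally) $$T_{w,\sigma}f(x)=\sum_{I\in\mathcal{D}}\sigma_I\,\frac{w(x)}{\langle w\rangle_I}\,\langle f,h_I\rangle\,h_I(x).$$ The weighted dyadic square function is $$S_w^df(x)=\Big(\sum_{I\in\mathcal{D}}|\langle f\rangle_I^w-\langle f\rangle_{\widetilde I}^w|^2\,\mathbf{1}_I(x)\Big)^{1/2}.$$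 An operator $T$ is bounded from $L^2(u)$ into $L^2(v)$ if there is $C>0$ with $\|Tf\|_{L^2(v)}\le C\|f\|_{L^2(u)}$ for all $f\in L^2(u)$; uniformly in $\sigma$ means $C$ can be chosen independent of $\sigma$. Finally, $$Q_J(u,v,w)=\frac{1}{|J|}\sum_{I\in\mathcal{D}(J):\,I\ne J}|\widetilde I|\left|\frac{\langle u^{-1}\rangle_I}{\langle w\rangle_I}\right|^2\left|1-\frac{\langle w\rangle_I}{\langle w\rangle_{\widetilde I}}\right|^2\langle vw^2\rangle_{\widetilde I},$$ $$R_J(u,v,w)=\frac{1}{|J|}\sum_{I\in\mathcal{D}(J):\,I\ne J}|\widetilde I|\left|\frac{\langle vw^2\rangle_I}{\langle w\rangle_I}\right|^2\left|1-\frac{\langle w\rangle_I}{\langle w\rangle_{\widetilde I}}\right|^2\langle u^{-1}\rangle_{\widetilde I}.$$ *)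

(* Defs.v *)
From HB Require Import structures.
From mathcomp Require Import all_boot all_order all_algebra.
From mathcomp Require Import finmap.
From mathcomp Require Import all_classical all_reals all_analysis.
From mathcomp Require Import summability.

Set Implicit Arguments.
Unset Strict Implicit.
Unset Printing Implicit Defensive.

Import Order.TTheory GRing.Theory Num.Theory.
Import numFieldNormedType.Exports.

Local Open Scope classical_set_scope.
Local Open Scope ring_scope.

(* The pair (j, k) stands for the interval [k 2^-j, (k+1) 2^-j); this
   parametrization of the dyadic intervals is one-to-one. *)
Definition dyadic := (int * int)%type.

(* Floor division, so that negative k is handled correctly. *)
Definition parent (I : dyadic) : dyadic := (I.1 - 1, (I.2 %/ 2)%Z).
Definition lhalf (I : dyadic) : dyadic := (I.1 + 1, 2 * I.2).
Definition rhalf (I : dyadic) : dyadic := (I.1 + 1, 2 * I.2 + 1).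

Section TwoWeight.
Variable R : realType.
Local Notation mu := (@lebesgue_measure R).
Implicit Types (f g u v w : R -> R) (I J : dyadic) (x : R).

Definition dlen I : R := 2 ^ (- I.1).

Definition dint I : set R :=
  [set x | I.2%:~R * dlen I <= x < (I.2 + 1)%:~R * dlen I].

Definition dsub J : set dyadic := [set I | dint I `<=` dint J].

Definition weight w : Prop :=
  {ae mu, forall x, 0 < w x} /\ locally_integrable setT w.

Definition wmeas w I : R := \int[mu]_(x in dint I) w x.

Definition avg g I : R := (dlen I)^-1 * \int[mu]_(x in dint I) g x.

Definition wavg w f I : R :=
  (wmeas w I)^-1 * \int[mu]_(x in dint I) (f x * w x).

Definition Delta g I : R := avg g (rhalf I) - avg g (lhalf I).

Definition dyadic_doubling w : Prop :=
  (ereal_sup (range (fun I => (wmeas w (parent I) / wmeas w I)%:E)) < +oo)%E.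

Definition haar I x : R :=
  (Num.sqrt (dlen I))^-1 * (\1_(dint (rhalf I)) x - \1_(dint (lhalf I)) x).

Definition pairing f g : R := \int[mu]_x (f x * g x).

Definition L2norm u (F : R -> \bar R) : \bar R :=
  ((\int[mu]_x (`|F x| ^+ 2 * (u x)%:E)) `^ 2^-1)%E.

Definition inL2 u f : Prop :=
  measurable_fun setT f /\ (L2norm u (EFin \o f) < +oo)%E.

Definition bounded_L2 u v (T : (R -> R) -> R -> \bar R) : Prop :=
  exists2 C : R, 0 < C & forall f, inL2 u f ->
    (L2norm v (T f) <= C%:E * L2norm u (EFin \o f))%E.

Definition signs (sigma : dyadic -> R) : Prop :=
  forall I, sigma I = 1 \/ sigma I = -1.

Definition haar_mult_term w (sigma : dyadic -> R) f I x : R :=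
  sigma I * (w x / avg w I) * pairing f (haar I) * haar I x.

(* The formal series T_{w,sigma} f has sum g when its partial sums over finite
   families of dyadic intervals converge to g in L^2(v), along the directed
   set of all finite families (unconditional convergence). *)
Definition haar_mult_sum v w (sigma : dyadic -> R) f g : Prop :=
  measurable_fun setT g /\
  (fun A : {fset dyadic} =>
     L2norm v (fun x => (g x - \sum_(I <- A) haar_mult_term w sigma f I x)%:E))
    @ totally --> 0%E.

Definition haar_mult_unif_bounded u v w : Prop :=
  exists2 C : R, 0 < C & forall sigma, signs sigma ->
    forall f, inL2 u f -> exists2 g, haar_mult_sum v w sigma f g &
      (L2norm v (EFin \o g) <= C%:E * L2norm u (EFin \o f))%E.

Definition square_fun w f x : \bar R :=
  ((\esum_(I in [set: dyadic])
      (`|wavg w f I - wavg w f (parent I)| ^+ 2 * \1_(dint I) x)%:E)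
   `^ 2^-1)%E.

(* The sum of a family of reals is the sum of its positive parts minus the sum
   of its negative parts; since +oo - +oo = -oo, a series that does not
   converge absolutely gets an infinite value, hence counts as unbounded. *)
Definition pos_op w (lambda : dyadic -> R) f x : \bar R :=
  let a I := (w x / dlen I * lambda I * avg f I * \1_(dint I) x)%:E in
  (\esum_(I in [set: dyadic]) a^\+ I - \esum_(I in [set: dyadic]) a^\- I)%E.

Definition Qsum u v w J : \bar R :=
  ((dlen J)^-1%:E * \esum_(I in dsub J `\ J)
     (dlen (parent I)
      * `|avg (fun x => (u x)^-1) I / avg w I| ^+ 2
      * `|1 - avg w I / avg w (parent I)| ^+ 2
      * avg (fun x => v x * w x ^+ 2) (parent I))%:E)%E.

Definition Rsum u v w J : \bar R :=
  ((dlen J)^-1%:E * \esum_(I in dsub J `\ J)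
     (dlen (parent I)
      * `|avg (fun x => v x * w x ^+ 2) I / avg w I| ^+ 2
      * `|1 - avg w I / avg w (parent I)| ^+ 2
      * avg (fun x => (u x)^-1) (parent I))%:E)%E.

Definition lambda_coef u v w I : R :=
  `|Delta (fun x => (u x)^-1) I| / avg (fun x => (u x)^-1) I
  * (`|Delta (fun x => v x * w x ^+ 2) I| / avg (fun x => v x * w x ^+ 2) I)
  * (dlen I / avg w I).

End TwoWeight.

(* Main.v *)
Require Import Defs.
From HB Require Import structures.
From mathcomp Require Import all_boot all_order all_algebra.
From mathcomp Require Import finmap.
From mathcomp Require Import all_classical all_reals all_analysis.
From mathcomp Require Import measurable_realfun summability.
From mathcomp Require Import zify ring lra.

(* With s = u^-1 and r = v w^2, the uniform bound for T_(w,sigma) is a bound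
   for the bilinear forms sum_I <phi,h_I> <psi,h_I> / <w>_I over all choices of
   signs, where phi and psi have norms int phi^2 / s and int psi^2 / r.
   Subtracting from h_I its mean for the measure s (resp. r) writes
   <phi,h_I> = A_I + A'_I, where A_I is controlled by Bessel's inequality for
   the Haar system of L^2(s), and A'_I is proportional to <phi>_I (resp.
   <psi,h_I> = B_I + B'_I).  In
     <phi,h_I> <psi,h_I> = A_I <psi,h_I> + <phi,h_I> B_I - A_I B_I + A'_I B'_I
   the last term is the form of the positive operator, and the others are
   bounded by sum_I <phi,h_I>^2 <r>_I / <w>_I^2 and its dual, the joint A_2
   condition being a consequence of these.  Conversely these two sums are
   bounded by choosing the signs suitably.  Up to the paraproduct terms, which the
   hypotheses on Q_J and R_J control through Carleson embedding, they are the
   square function bounds (i) and (ii). *)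

Set Implicit Arguments.
Unset Strict Implicit.
Unset Printing Implicit Defensive.

Import Order.TTheory GRing.Theory Num.Theory.
Import numFieldNormedType.Exports.
Local Open Scope classical_set_scope.
Local Open Scope ring_scope.

(** * Dyadic trees *)

(** Finite families of intervals suffice throughout, since the constants do not depend on the
    family. Each family lies in two finite trees, so the Bessel and Carleson estimates become
    inductions on depth. About L^2 they use only the Cauchy-Schwarz bound phi(K)^2 <= s(K) E(K) with
    an additive energy E. The terms of the Haar series need not be orthogonal in the weighted space,
    and two sign arguments replace orthogonality. Signs that make all cross terms nonnegative bound
    the sum of the squared norms by the norm of one signed sum. Uniformly bounded signed sums
    converge unconditionally, which supplies the sum whose existence is part of the boundedness of
    T_(w,sigma). Conversely, the full sums for two sign families that agree on A and are opposite
    off A add up to twice the finite sum over A. Doubling of w serves to return from the jumps of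
    phi to the differences phi(I)/w(I) - phi(parent)/w(parent), where one divides by the mass of a
    child. *)

Lemma parent_lhalf I : parent (lhalf I) = I.
Proof. by case: I => j k; rewrite /parent /lhalf /=; congr pair; lia. Qed.

Lemma parent_rhalf I : parent (rhalf I) = I.
Proof. by case: I => j k; rewrite /parent /rhalf /=; congr pair; lia. Qed.

Lemma dyadic_half I : I = lhalf (parent I) \/ I = rhalf (parent I).
Proof.
case: I => j k; rewrite /lhalf /rhalf /parent /=.
have [e|e] : (k = 2 * (k %/ 2)%Z \/ k = 2 * (k %/ 2)%Z + 1) by lia.
- by left; congr pair; lia.
- by right; congr pair; lia.
Qed.

Lemma lhalf_neq_rhalf I J : lhalf I <> rhalf J.
Proof. by case: I J => [j k] [j' k'] [] _; lia. Qed.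

Lemma lhalf_inj : injective lhalf.
Proof. by move=> I J /(congr1 parent); rewrite !parent_lhalf. Qed.

Lemma rhalf_inj : injective rhalf.
Proof. by move=> I J /(congr1 parent); rewrite !parent_rhalf. Qed.

Definition children (A : seq dyadic) := map lhalf A ++ map rhalf A.

Lemma children_uniq A : uniq A -> uniq (children A).
Proof.
move=> uA; rewrite cat_uniq !map_inj_uniq ?uA /=; last 2 first.
- exact: rhalf_inj.
- exact: lhalf_inj.
rewrite andbT; apply/hasPn => _ /mapP[I _ ->]; apply/negP => /mapP[J _].
by move/esym/lhalf_neq_rhalf.
Qed.

Lemma parent_children A I : parent I \in A -> I \in children A.
Proof.
rewrite mem_cat; case: (dyadic_half I) => eI pA.
  by apply/orP; left; apply/mapP; exists (parent I).
by apply/orP; right; apply/mapP; exists (parent I).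
Qed.

Lemma children_sub A I : I \in children A -> parent I \in A.
Proof.
by rewrite mem_cat => /orP[] /mapP[J JA ->]; rewrite ?parent_lhalf ?parent_rhalf.
Qed.

Fixpoint tree n (J : dyadic) : seq dyadic :=
  if n is n'.+1 then J :: tree n' (lhalf J) ++ tree n' (rhalf J) else [::].

Lemma tree_ancestor n J K : K \in tree n J ->
  exists2 m, (m < n)%N & iter m parent K = J.
Proof.
elim: n J => // n IHn J; rewrite inE mem_cat => /orP[/eqP ->|/orP[]].
- by exists 0%N.
- by case/IHn => m mn e; exists m.+1 => //=; rewrite e parent_lhalf.
- by case/IHn => m mn e; exists m.+1 => //=; rewrite e parent_rhalf.
Qed.

Lemma iter_parent_level m K : (iter m parent K).1 = K.1 - m%:Z.
Proof. by elim: m => [|m] /=; [lia|rewrite /parent /= => ->; lia]. Qed.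

Lemma tree_mono n m J : (n <= m)%N -> {subset tree n J <= tree m J}.
Proof.
elim: n m J => // n IHn [//|m] J nm K; rewrite !inE !mem_cat.
by case/or3P => [->//|/IHn->//|/IHn->//]; rewrite !orbT.
Qed.

Lemma ancestor_tree m K : K \in tree m.+1 (iter m parent K).
Proof.
elim: m => [|m IHm]; first by rewrite inE.
rewrite inE mem_cat /=.
by case: (dyadic_half (iter m parent K)) => e; apply/or3P;
  [apply: Or32|apply: Or33]; rewrite -e.
Qed.

Lemma tree_uniq n J : uniq (tree n J).
Proof.
elim: n J => // n IHn J; rewrite /= cat_uniq !IHn mem_cat negb_or /= andbT.
apply/andP; split.
  apply/andP; split; apply/negP => /tree_ancestor[m _] /(congr1 fst);
    by rewrite iter_parent_level /=; lia.
apply/hasPn => K /tree_ancestor[m _ e]; apply/negP => /tree_ancestor[m' _ e'].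
(* Both halves of J have the same level, so the same number of parent steps leads from K to either
   of them. *)
have emm' : m = m'.
  move: (congr1 fst e) (congr1 fst e'); rewrite !iter_parent_level /=; lia.
by apply: (@lhalf_neq_rhalf J J); rewrite -e -e' emm'.
Qed.

(** The fixed points of floor division by 2 are 0 and -1. Each step shortens the range by at least
    one at both ends, which is far from sharp but enough. *)
Lemma iter_parent_root (n : nat) (K : dyadic) : - n.+1%:Z <= K.2 <= n%:Z ->
  (iter n parent K).2 = 0 \/ (iter n parent K).2 = -1.
Proof.
elim: n K => [|n IHn] K; first by rewrite /=; lia.
rewrite iterSr => h; apply: IHn; rewrite /parent /=; lia.
Qed.

(* No dyadic interval meets both sides of the origin, so two roots are needed. *)
Lemma tree_cover (A : seq dyadic) : exists n j,
  forall I : dyadic, I \in A -> I \in tree n (j, 0) ++ tree n (j, -1).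
Proof.
pose N := (\max_(I <- A) (absz I.1 + absz I.2))%N.
(* An interval I of A is m = I.1 + 2 N levels below the roots. Here m >= N bounds the index of I, so
   that m parent steps end at 0 or -1, and m <= 3 N bounds the depth. *)
exists (3 * N).+2, (- (2 * N)%N%:Z) => I IA.
have leN : (absz I.1 + absz I.2 <= N)%N.
  by rewrite /N (big_rem _ IA) /=; exact: leq_maxl.
pose m := absz (I.1 + (2 * N)%N%:Z).
have hm : m%:Z = I.1 + (2 * N)%N%:Z by rewrite /m; lia.
have h2 : (iter m parent I).2 = 0 \/ (iter m parent I).2 = -1.
  by apply: iter_parent_root; lia.
have h1 : (iter m parent I).1 = - (2 * N)%N%:Z.
  by rewrite iter_parent_level; lia.
have hI : I \in tree (3 * N).+2 (iter m parent I).
  by apply: (@tree_mono m.+1); [lia|exact: ancestor_tree].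
rewrite mem_cat; apply/orP.
by case: h2 => h2; [left|right];
  move: hI; rewrite (surjective_pairing (iter m parent I)) h1 h2.
Qed.

Section Sums.
Variable R : realFieldType.
Implicit Types x y : dyadic -> R.

Lemma sum_sub (T : eqType) (f : T -> R) (A B : seq T) :
  (forall I, 0 <= f I) -> uniq A -> {subset A <= B} ->
  \sum_(I <- A) f I <= \sum_(I <- B) f I.
Proof.
move=> f0; elim: A B => [|a A IHA] B /=; first by rewrite big_nil sumr_ge0.
move=> /andP[aA uA] AB; rewrite big_cons.
have aB : a \in B by apply: AB; exact: mem_head.
rewrite (big_rem a aB) /= lerD2l; apply: IHA => // b bA.
have bB : b \in B by apply: AB; rewrite inE bA orbT.
move: bB; rewrite (perm_mem (perm_to_rem aB)) inE => /predU1P[ba|//].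
by rewrite -ba bA in aA.
Qed.

Lemma sum_children x A :
  \sum_(I <- children A) x I = \sum_(K <- A) (x (lhalf K) + x (rhalf K)).
Proof. by rewrite big_cat !big_map big_split. Qed.

(** Bellman function principle: the potential with n + 1 generations left pays for the term at K and
    for both children with n generations left. *)
Lemma tree_potential (x : dyadic -> R) (B : nat -> dyadic -> R) :
  (forall K, 0 <= B 0%N K) ->
  (forall n K, x K + B n (lhalf K) + B n (rhalf K) <= B n.+1 K) ->
  forall n J, \sum_(K <- tree n J) x K <= B n J.
Proof.
move=> B0 BS; elim=> [|n IHn] J; first by rewrite big_nil.
rewrite big_cons big_cat /=; apply: le_trans (BS n J).
by rewrite -addrA lerD2l lerD.
Qed.

Lemma sum_tree_cover x (c : R) (A : seq dyadic) : (forall I, 0 <= x I) ->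
  uniq A ->
  (forall n j, \sum_(K <- tree n (j, 0)) x K
     + \sum_(K <- tree n (j, -1)) x K <= c) ->
  \sum_(I <- A) x I <= c.
Proof.
move=> x0 uA hc; have [n [j Aj]] := tree_cover A.
by apply: le_trans (hc n j); rewrite -big_cat; apply: sum_sub.
Qed.

End Sums.

(** * Bessel, Carleson and square function estimates for dyadic sums *)

Section DyadicSums.
Variable R : realFieldType.
Implicit Types (s r w d phi psi E : dyadic -> R) (K J : dyadic).

Definition dyadic_additive phi := forall K, phi K = phi (lhalf K) + phi (rhalf K).

(** When phi gives the integrals of a function over the intervals, this is |K|^(1/2) times its Haar
    coefficient. *)
Definition jump phi K := phi (rhalf K) - phi (lhalf K).

(** This is |K|^(1/2) times the A_I of the overview; the subtracted part corresponds to A'_I. *)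
Definition osc s phi K := jump phi K - jump s K * (phi K / s K).

(** E K stands for the integral of phi^2 / s over K. The last clause bounds the total energy, two
    roots at a time, one on each side of the origin. *)
Definition energy_bound s phi (N : R) := exists2 E : dyadic -> R,
  dyadic_additive E & (forall K, phi K ^+ 2 <= s K * E K) /\
               (forall j, E (j, 0) + E (j, -1) <= N).

Lemma sqr_div_convex (a b s t : R) : 0 < s -> 0 < t ->
  (a + b) ^+ 2 / (s + t) <= a ^+ 2 / s + b ^+ 2 / t.
Proof.
move=> s0 t0; have st : 0 < s + t by rewrite addr_gt0.
rewrite -subr_ge0.
have -> : a ^+ 2 / s + b ^+ 2 / t - (a + b) ^+ 2 / (s + t)
    = (a * t - b * s) ^+ 2 / (s * t * (s + t)).
  by field; rewrite !gt_eqF.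
by rewrite divr_ge0 ?sqr_ge0// !mulr_ge0 ?ltW.
Qed.

Section Energy.
Variables (s phi : dyadic -> R) (N : R).
Hypotheses (s0 : forall K, 0 < s K) (sD : dyadic_additive s) (phiD : dyadic_additive phi).
Hypothesis hE : energy_bound s phi N.

(** With masses a, b of s and f, g of phi on the halves, the right side is (g a - f b)^2 / (a b (a +
    b)) and the left side is 4 (g a - f b)^2 / (a + b)^3, so the claim is 4 a b <= (a + b)^2. *)
Lemma osc_sqr_le K : osc s phi K ^+ 2 / s K <=
  phi (lhalf K) ^+ 2 / s (lhalf K) + phi (rhalf K) ^+ 2 / s (rhalf K)
  - phi K ^+ 2 / s K.
Proof.
have l0 := s0 (lhalf K); have r0 := s0 (rhalf K).
rewrite /osc /jump (sD K) (phiD K).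
move: (s (lhalf K)) (s (rhalf K)) (phi (lhalf K)) (phi (rhalf K)) l0 r0 => a b f g a0 b0.
have ab0 : 0 < a + b by rewrite addr_gt0.
rewrite -subr_ge0.
have -> : f ^+ 2 / a + g ^+ 2 / b - (f + g) ^+ 2 / (a + b)
   - (g - f - (b - a) * ((f + g) / (a + b))) ^+ 2 / (a + b)
   = (g * a - f * b) ^+ 2 * (a - b) ^+ 2 / (a * b * (a + b) ^+ 3).
  by field; rewrite !gt_eqF.
by rewrite divr_ge0 // mulr_ge0 ?sqr_ge0 ?exprn_ge0 // ?mulr_ge0 ?ltW.
Qed.

(** The potential E - phi^2 / s is the energy left after removing the mean over K. It is nonnegative
    by Cauchy-Schwarz, and [osc_sqr_le] bounds its drop from below. *)
Lemma bessel_osc (A : seq dyadic) : uniq A ->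
  \sum_(K <- A) osc s phi K ^+ 2 / s K <= N.
Proof.
move=> uA; case: hE => E ED [phiE EN].
have hx K : 0 <= osc s phi K ^+ 2 / s K by rewrite divr_ge0 ?sqr_ge0 ?ltW.
have hB K : 0 <= E K - phi K ^+ 2 / s K.
  by rewrite subr_ge0 ler_pdivrMr// mulrC.
have T n J : \sum_(K <- tree n J) osc s phi K ^+ 2 / s K <= E J.
  apply: (@le_trans _ _ (E J - phi J ^+ 2 / s J)); last first.
    by rewrite gerBl divr_ge0 ?sqr_ge0 ?ltW.
  apply: (@tree_potential _ _ (fun=> fun K => E K - phi K ^+ 2 / s K)) => //.
  move=> _ K; have := osc_sqr_le K; rewrite (ED K); lra.
apply: sum_tree_cover => // n j.
exact: le_trans (lerD (T _ _) (T _ _)) (EN j).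
Qed.

(* Bellman function of the embedding: with D the mass of d below K, the value
   4 C (E - C phi^2 / (C s + D)) drops by at least d phi^2 / s^2 from K to its
   children, because C s + D <= 2 C s. *)
Lemma carleson_embedding d (C : R) (A : seq dyadic) : 0 < C ->
  (forall K, 0 <= d K) ->
  (forall n J, \sum_(K <- tree n J) d K <= C * s J) -> uniq A ->
  \sum_(K <- A) d K * (phi K / s K) ^+ 2 <= 4 * C * N.
Proof.
move=> C0 d0 dC uA; case: hE => E ED [phiE EN].
have T n J : \sum_(K <- tree n J) d K * (phi K / s K) ^+ 2 <= 4 * C * E J.
  pose D n K := \sum_(L <- tree n K) d L.
  have D0 m K : 0 <= D m K by apply: sumr_ge0.
  have S0 m K : 0 < C * s K + D m K by rewrite ltr_wpDr// mulr_gt0.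
  pose B m K := 4 * C * (E K - C * phi K ^+ 2 / (C * s K + D m K)).
  apply: (@le_trans _ _ (B n J)); last first.
    rewrite /B ler_pM2l ?mulr_gt0// gerBl.
    by apply: divr_ge0 (ltW _) => //; rewrite mulr_ge0 ?sqr_ge0 ?ltW.
  apply: (@tree_potential _ _ B) => [K|m K].
    rewrite /B /D big_nil addr0; apply: mulr_ge0; first by rewrite mulr_ge0 ?ltW.
    rewrite invfM mulrACA divff ?gt_eqF// mul1r subr_ge0 ler_pdivrMr//.
    by rewrite mulrC.
  have DS : D m.+1 K = d K + (D m (lhalf K) + D m (rhalf K)).
    by rewrite /D /= big_cons big_cat.
  have SK : C * s K + D m.+1 K <= 2 * C * s K.
    by have := dC m.+1 K; rewrite -/(D _ _); lra.
  have := S0 m.+1 K; have := S0 m (lhalf K); have := S0 m (rhalf K).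
  move: SK; rewrite /B (ED K) (phiD K) DS.
  have := s0 K; have := d0 K; rewrite (sD K).
  move: (d K) (D m (lhalf K)) (D m (rhalf K)) (s (lhalf K)) (s (rhalf K)).
  move: (phi (lhalf K)) (phi (rhalf K)) (E (lhalf K)) (E (rhalf K)).
  move=> f g e1 e2 dK D1 D2 s1 s2 dK0 s12 SK S2 S1 S12.
  have S12' : 0 < (C * s1 + D1) + (C * s2 + D2) by rewrite addr_gt0.
  have cvx := sqr_div_convex f g S1 S2.
  set U := C * s1 + D1 in S1 cvx S12' *; set V := C * s2 + D2 in S2 cvx S12' *.
  have eW : C * (s1 + s2) + (dK + (D1 + D2)) = U + V + dK by rewrite /U /V; ring.
  rewrite eW in SK S12 *.
  (* Convexity of x^2 / y has merged the two children; what remains is the growth of the denominator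
     by dK. Both U + V and U + V + dK are at most 2 C s, and squaring that 2 gives the constant
     4. *)
  suff : dK * ((f + g) / (s1 + s2)) ^+ 2 <= 4 * C ^+ 2 *
     ((f + g) ^+ 2 / (U + V) - (f + g) ^+ 2 / (U + V + dK)).
    move: cvx; rewrite -(ler_pM2l (_ : 0 < 4 * C ^+ 2)); last first.
      by rewrite mulr_gt0// exprn_gt0.
    by lra.
  have -> : (f + g) ^+ 2 / (U + V) - (f + g) ^+ 2 / (U + V + dK)
     = dK * (f + g) ^+ 2 / ((U + V) * (U + V + dK)).
    by field; rewrite !gt_eqF.
  have -> : dK * ((f + g) / (s1 + s2)) ^+ 2 = 4 * C ^+ 2 *
      (dK * (f + g) ^+ 2 / ((2 * C * (s1 + s2)) ^+ 2)).
    by field; rewrite !gt_eqF.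
  rewrite ler_pM2l ?mulr_gt0 ?exprn_gt0// ler_wpM2l ?(mulr_ge0 dK0 (sqr_ge0 _))//.
  rewrite lef_pV2 ?posrE ?mulr_gt0 ?exprn_gt0 ?mulr_gt0//.
  rewrite expr2 ler_pM ?(ltW S12') ?(ltW S12)//; lra.
apply: sum_tree_cover => // [K|n j].
  exact: mulr_ge0 (sqr_ge0 _).
apply: le_trans (lerD (T _ _) (T _ _)) _.
by rewrite -mulrDr ler_pM2l ?mulr_gt0.
Qed.

End Energy.

Lemma ler_norm_mul (a b c : R) : 0 < c -> `|a * b| <= (a ^+ 2 / c + b ^+ 2 * c) / 2.
Proof.
move=> c0; rewrite ler_norml; apply/andP; split; rewrite -subr_ge0.
  have -> : a * b - - ((a ^+ 2 / c + b ^+ 2 * c) / 2) = (a + b * c) ^+ 2 / c / 2.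
    by field; rewrite gt_eqF.
  by rewrite !divr_ge0 ?sqr_ge0 ?ltW.
have -> : (a ^+ 2 / c + b ^+ 2 * c) / 2 - a * b = (a - b * c) ^+ 2 / c / 2.
  by field; rewrite gt_eqF.
by rewrite !divr_ge0 ?sqr_ge0 ?ltW.
Qed.

(* With p = A + A' and q = B + B', p q - A' B' = A q + p B - A B. *)
Lemma bilinear_error (s r w C p q A B : R) : 0 < s -> 0 < r -> 0 < w ->
  s * r <= C * w ^+ 2 ->
  `|p * q - (p - A) * (q - B)| / w <=
  A ^+ 2 / s + (1 + C) * (B ^+ 2 / r) + q ^+ 2 * s / w ^+ 2 + p ^+ 2 * r / w ^+ 2.
Proof.
move=> s0 r0 w0 srC; have w2 : 0 < w ^+ 2 by rewrite exprn_gt0.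
have -> : p * q - (p - A) * (q - B) = A * q + B * p - A * B by ring.
(* This comes from the product A B, and it is the one place where the joint A_2 bound enters the
   error estimate. *)
have B2 : B ^+ 2 * s / w ^+ 2 <= C * (B ^+ 2 / r).
  have -> : C * (B ^+ 2 / r) = B ^+ 2 * (C / r) by ring.
  rewrite -mulrA ler_wpM2l ?sqr_ge0// ler_pdivrMr// mulrAC ler_pdivlMr//.
have h (x y t : R) : 0 < t -> `|x * y| / w <= (x ^+ 2 / t + y ^+ 2 * t / w ^+ 2) / 2.
  move=> t0; have := @ler_norm_mul x (y / w) t t0.
  rewrite mulrA normrM (gtr0_norm (_ : 0 < w^-1)) ?invr_gt0//.
  have -> : (y / w) ^+ 2 * t = y ^+ 2 * t / w ^+ 2 by field; rewrite gt_eqF.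
  by [].
have h1 := h A q s s0; have h2 := h B p r r0; have h3 := h A B s s0.
have P1 : 0 <= A ^+ 2 / s by rewrite divr_ge0 ?sqr_ge0 ?ltW.
have P2 : 0 <= B ^+ 2 / r by rewrite divr_ge0 ?sqr_ge0 ?ltW.
have P3 : 0 <= q ^+ 2 * s / w ^+ 2 by rewrite divr_ge0 ?sqr_ge0// mulr_ge0 ?sqr_ge0 ?ltW.
have P4 : 0 <= p ^+ 2 * r / w ^+ 2 by rewrite divr_ge0 ?sqr_ge0// mulr_ge0 ?sqr_ge0 ?ltW.
have P5 : 0 <= B ^+ 2 * s / w ^+ 2 by rewrite divr_ge0 ?sqr_ge0// mulr_ge0 ?sqr_ge0 ?ltW.
have : `|A * q + B * p - A * B| / w <= `|A * q| / w + `|B * p| / w + `|A * B| / w.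
  rewrite -!mulrDl ler_pM2r ?invr_gt0//.
  by apply: le_trans (ler_normB _ _) _; rewrite lerD2r ler_normD.
lra.
Qed.

(** * Differences of phi / w on children against jumps of phi *)

Section SquareFunction.
Variables (w : dyadic -> R) (r phi : dyadic -> R).
Hypotheses (w0 : forall K, 0 < w K) (wD : dyadic_additive w).
Hypotheses (r0 : forall K, 0 < r K) (rD : dyadic_additive r) (phiD : dyadic_additive phi).

Definition wdiff I := phi I / w I - phi (parent I) / w (parent I).

(** For phi = f w this is the contribution of I to the squared norm of the square function of f in
    L^2(r). *)
Definition wdiff_energy I := wdiff I ^+ 2 * r I.

(** In averages, <phi,h_K>^2 <r>_K / <w>_K^2: the lengths cancel. *)
Definition jump_energy K := jump phi K ^+ 2 * r K / w K ^+ 2.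

Definition paraproduct_energy K :=
  phi K ^+ 2 * (jump w K / w K) ^+ 2 * r K / w K ^+ 2.

Definition children_energy K := wdiff_energy (lhalf K) + wdiff_energy (rhalf K).

(* Both children see the same numerator, up to sign. *)
Lemma children_energyE K : children_energy K =
  ((jump phi K - phi K * (jump w K / w K)) / 2) ^+ 2 *
  (r (lhalf K) / w (lhalf K) ^+ 2 + r (rhalf K) / w (rhalf K) ^+ 2).
Proof.
have l0 := w0 (lhalf K); have rr0 := w0 (rhalf K).
rewrite /children_energy /wdiff_energy /wdiff parent_lhalf parent_rhalf /jump.
rewrite (phiD K) (wD K); have lr0 : 0 < w (lhalf K) + w (rhalf K) by rewrite addr_gt0.
move: (w (lhalf K)) (w (rhalf K)) l0 rr0 lr0 => a b a0 b0 ab0.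
by field; rewrite !gt_eqF.
Qed.

(** This is x^2 <= 2 (x - y z)^2 + 2 (y z)^2, where x is the jump and y z the paraproduct part;
    halving inside [children_energyE] turns the first 2 into 8. The factor r / w^2 only grows on the
    children, because w is smaller there. *)
Lemma jump_energy_le K :
  jump_energy K <= 8 * children_energy K + 2 * paraproduct_energy K.
Proof.
have h x t (x0 : 0 < x) (t0 : 0 <= t) : 0 < w K -> x <= w K ->
    t / w K ^+ 2 <= t / x ^+ 2.
  move=> wK xw; rewrite ler_wpM2l// lef_pV2 ?posrE ?exprn_gt0//.
  by rewrite ler_sqr ?nnegrE ?(ltW x0) ?(ltW wK).
have hl := h (w (lhalf K)) (r (lhalf K)) (w0 _) (ltW (r0 _)) (w0 K).
have hr := h (w (rhalf K)) (r (rhalf K)) (w0 _) (ltW (r0 _)) (w0 K).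
have l0 := w0 (lhalf K); have rr0 := w0 (rhalf K).
have {}hl := hl ltac:(rewrite (wD K); lra).
have {}hr := hr ltac:(rewrite (wD K); lra).
have hs : r K / w K ^+ 2 <= r (lhalf K) / w (lhalf K) ^+ 2
                            + r (rhalf K) / w (rhalf K) ^+ 2.
  by rewrite (rD K) mulrDl lerD.
rewrite children_energyE /jump_energy /paraproduct_energy.
have := ler_wpM2l (sqr_ge0 ((jump phi K - phi K * (jump w K / w K)) / 2)) hs.
have q0 : 0 <= r K / w K ^+ 2 by rewrite divr_ge0 ?sqr_ge0 ?ltW.
rewrite -!(mulrA _ (r K)).
set Q := r (lhalf K) / _ + _.
move: (r K / _) (jump phi K) (phi K) (jump w K / w K) Q q0 => q x y z Q q0 hQ.
have e : 8 * (((x - y * z) / 2) ^+ 2 * q) + 2 * (y ^+ 2 * z ^+ 2 * q) - x ^+ 2 * q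
    = (x - 2 * (y * z)) ^+ 2 * q by field.
have := mulr_ge0 (sqr_ge0 (x - 2 * (y * z))) q0; lra.
Qed.

(** Here 1 / w^2 on a child must be bounded by its value on K, and this costs D^2. The constant from
    (x - y z)^2 is absorbed by the factor 1/4. *)
Lemma children_energy_le D K :
  w K <= D * w (lhalf K) -> w K <= D * w (rhalf K) ->
  children_energy K <= D ^+ 2 * (jump_energy K + paraproduct_energy K).
Proof.
move=> hl hr.
have h x t (x0 : 0 < x) (t0 : 0 <= t) : w K <= D * x ->
    t / x ^+ 2 <= D ^+ 2 * (t / w K ^+ 2).
  move=> wx; rewrite mulrCA ler_wpM2l// ler_pdivlMr ?exprn_gt0//.
  rewrite mulrC ler_pdivrMr ?exprn_gt0// -exprMn.
  by rewrite ler_sqr ?nnegrE ?(ltW (w0 K))// (le_trans (ltW (w0 K))).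
have {}hl := h _ _ (w0 _) (ltW (r0 (lhalf K))) hl.
have {}hr := h _ _ (w0 _) (ltW (r0 (rhalf K))) hr.
have hs : r (lhalf K) / w (lhalf K) ^+ 2 + r (rhalf K) / w (rhalf K) ^+ 2
    <= D ^+ 2 * (r K / w K ^+ 2).
  by rewrite (rD K) mulrDl mulrDr lerD.
rewrite children_energyE /jump_energy /paraproduct_energy.
have := ler_wpM2l (sqr_ge0 ((jump phi K - phi K * (jump w K / w K)) / 2)) hs.
have q0 : 0 <= D ^+ 2 * (r K / w K ^+ 2).
  by apply: mulr_ge0 (sqr_ge0 _) _; rewrite divr_ge0 ?sqr_ge0 ?ltW.
rewrite -!(mulrA _ (r K)) -mulrDl => hQ.
rewrite [in X in _ <= X]mulrCA; apply: le_trans hQ _; rewrite ler_wpM2r//.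
move: (jump phi K) (phi K) (jump w K / w K) => x y z.
have e : x ^+ 2 + y ^+ 2 * z ^+ 2 - ((x - y * z) / 2) ^+ 2
    = ((x + y * z) ^+ 2 + 2 * x ^+ 2 + 2 * (y * z) ^+ 2) / 4 by field.
rewrite -subr_ge0 e divr_ge0//.
have := sqr_ge0 (x + y * z); have := sqr_ge0 x; have := sqr_ge0 (y * z); lra.
Qed.

Variable s : dyadic -> R.
Hypotheses (s0 : forall K, 0 < s K) (sD : dyadic_additive s).

(** The summand of Q_J in terms of masses; the factor 2 is |parent I| / |I|. Exchanging s and r
    gives the summand of R_J. *)
Definition carleson_term I :=
  (s I / w I) ^+ 2 * (1 - 2 * (w I / w (parent I))) ^+ 2 * r (parent I).

Lemma paraproduct_energyE K : paraproduct_energy K =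
  (s K / w K) ^+ 2 * (jump w K / w K) ^+ 2 * r K * (phi K / s K) ^+ 2.
Proof.
by rewrite /paraproduct_energy; field; rewrite !gt_eqF.
Qed.

(* The oscillation of w is the same on both children, and one of them carries
   at least half of the mass of s. *)
Lemma carleson_term_le K :
  (s K / w K) ^+ 2 * (jump w K / w K) ^+ 2 * r K <=
  2 * (carleson_term (lhalf K) + carleson_term (rhalf K)).
Proof.
rewrite /carleson_term parent_lhalf parent_rhalf.
have l0 := w0 (lhalf K); have rr0 := w0 (rhalf K); have wK := w0 K.
have el : 1 - 2 * (w (lhalf K) / w K) = jump w K / w K.
  by rewrite /jump; move: wK; rewrite (wD K) => wK; field; rewrite gt_eqF.
have er : 1 - 2 * (w (rhalf K) / w K) = - (jump w K / w K).
  by rewrite /jump; move: wK; rewrite (wD K) => wK; field; rewrite gt_eqF.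
rewrite el er sqrrN -!mulrDl mulrA ler_wpM2r ?(ltW (r0 _))//.
rewrite mulrA ler_wpM2r ?sqr_ge0//.
have h x t (x0 : 0 < x) (t0 : 0 < t) : x <= w K -> (t / w K) ^+ 2 <= (t / x) ^+ 2.
  move=> xw; rewrite ler_sqr ?nnegrE ?divr_ge0 ?(ltW t0) ?(ltW x0) ?(ltW wK)//.
  by rewrite ler_pM2l// lef_pV2 ?posrE.
have := h _ _ l0 (s0 (lhalf K)) ltac:(rewrite (wD K); lra).
have := h _ _ rr0 (s0 (rhalf K)) ltac:(rewrite (wD K); lra).
rewrite (sD K) mulrDl; move: (_ / w K) (_ / w K) => x y.
by have := sqr_ge0 (x - y); rewrite !expr2; nra.
Qed.

End SquareFunction.

End DyadicSums.

(** * Weighted L2 spaces *)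

Section WeightedL2.
Variable R : realType.
Local Notation mu := (@lebesgue_measure R).
Implicit Types (t a b c : R -> R) (F : R -> \bar R).

Definition sqint t a := measurable_fun [set: R] a /\
  mu.-integrable [set: R] (EFin \o (fun x => a x ^+ 2 * t x)).

Definition ip t a b : R := \int[mu]_x (a x * b x * t x).

Definition sqenergy t F : \bar R := (\int[mu]_x (`|F x| ^+ 2 * (t x)%:E))%E.

Section FixedWeight.
Variable t : R -> R.
Hypotheses (mt : measurable_fun [set: R] t) (t0 : forall x, 0 <= t x).

Lemma sqint_integrable a b : sqint t a -> sqint t b ->
  mu.-integrable [set: R] (EFin \o (fun x => a x * b x * t x)).
Proof.
move=> [ma ia] [mb ib].
apply: (@le_integrable _ _ _ mu _ _ _
  (EFin \o (fun x => a x ^+ 2 * t x + b x ^+ 2 * t x))) => //.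
- by apply/measurable_EFinP; do 2 apply: measurable_funM => //.
- move=> x _ /=; rewrite lee_fin.
  rewrite -mulrDl normrM (ger0_norm (t0 x)) [leRHS]ger0_norm; last first.
    by rewrite mulr_ge0// addr_ge0 ?sqr_ge0.
  rewrite ler_wpM2r//; have := @ler_norm_mul _ (a x) (b x) 1 ltr01.
  by rewrite divr1 mulr1 => /le_trans; apply; rewrite ler_pdivrMr// ler_peMr
    ?addr_ge0 ?sqr_ge0// ler1n.
- by have := integrableD measurableT ia ib; apply: eq_integrable.
Qed.

Lemma sqintZ (k : R) a : sqint t a -> sqint t (fun x => k * a x).
Proof.
move=> [ma ia]; split; first by apply: measurable_funM => //; exact: measurable_cst.
have := integrableZl measurableT (k ^+ 2) ia; apply: eq_integrable => //.
by move=> x _ /=; rewrite -EFinM exprMn mulrA.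
Qed.

Lemma sqintD a b : sqint t a -> sqint t b -> sqint t (fun x => a x + b x).
Proof.
move=> ha hb; have ab := sqint_integrable ha hb.
split; first by apply: measurable_funD; [case: ha|case: hb].
have [_ ia] := ha; have [_ ib] := hb.
have := integrableD measurableT (integrableD measurableT ia ib)
  (integrableZl measurableT 2 ab).
apply: eq_integrable => // x _ /=.
by rewrite -!EFinM -!EFinD; congr EFin; ring.
Qed.

Lemma sqint0 : sqint t (fun=> 0).
Proof.
split; first exact: measurable_cst.
apply: (eq_integrable measurableT (cst 0%E)) (integrable0 _ _) => x _ /=.
by rewrite expr0n mul0r.
Qed.

Lemma sqint_sum (T : Type) (A : seq T) (e : T -> R -> R) :
  (forall i, sqint t (e i)) -> sqint t (fun x => \sum_(i <- A) e i x).
Proof.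
move=> he; elim: A => [|i A IHA].
  by under [X in sqint _ X]funext do rewrite big_nil; exact: sqint0.
under [X in sqint _ X]funext do rewrite big_cons; exact: sqintD.
Qed.

Lemma ipC a b : ip t a b = ip t b a.
Proof. by rewrite /ip; under eq_Rintegral do rewrite [a _ * _]mulrC. Qed.

Lemma ip_ge0 a : 0 <= ip t a a.
Proof. by apply: Rintegral_ge0 => x _; rewrite -expr2 mulr_ge0 ?sqr_ge0. Qed.

Lemma ipDl a b c : sqint t a -> sqint t b -> sqint t c ->
  ip t (fun x => a x + b x) c = ip t a c + ip t b c.
Proof.
move=> ha hb hc; rewrite /ip.
under eq_Rintegral do rewrite mulrDl mulrDl.
by rewrite RintegralD//; exact: sqint_integrable.
Qed.

Lemma ipZl (k : R) a b : sqint t a -> sqint t b ->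
  ip t (fun x => k * a x) b = k * ip t a b.
Proof.
move=> ha hb; rewrite /ip; under eq_Rintegral do rewrite -2!mulrA.
under eq_Rintegral do rewrite mulrA.
rewrite -RintegralZl//; last exact: sqint_integrable.
by apply: eq_Rintegral => x _; ring.
Qed.

Lemma ip_suml (T : Type) (A : seq T) (e : T -> R -> R) b :
  (forall i, sqint t (e i)) -> sqint t b ->
  ip t (fun x => \sum_(i <- A) e i x) b = \sum_(i <- A) ip t (e i) b.
Proof.
move=> he hb; elim: A => [|i A IHA].
  rewrite big_nil -[RHS](Rintegral_set0 mu (cst 0)) /ip.
  under eq_Rintegral do rewrite big_nil !mul0r.
  by rewrite Rintegral_set0 /Rintegral integral0.
rewrite big_cons -IHA -ipDl//; last exact: sqint_sum.
by rewrite /ip; under eq_Rintegral do rewrite big_cons.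
Qed.

Lemma ipDD a b : sqint t a -> sqint t b ->
  ip t (fun x => a x + b x) (fun x => a x + b x)
  = ip t a a + 2 * ip t a b + ip t b b.
Proof.
move=> ha hb; have hab := sqintD ha hb.
rewrite ipDl// ![ip t _ (fun x => _ + _)]ipC !ipDl// (ipC b a); ring.
Qed.

Lemma ipBB a b : sqint t a -> sqint t b ->
  ip t (fun x => a x - b x) (fun x => a x - b x)
  = ip t a a - 2 * ip t a b + ip t b b.
Proof.
move=> ha hb; have hb' := sqintZ (-1) hb.
have e : (fun x => a x - b x) = (fun x => a x + -1 * b x).
  by apply/funext => x; ring.
have e1 c : sqint t c -> ip t c (fun x => -1 * b x) = - ip t c b.
  by move=> hc; rewrite ipC ipZl// ipC mulN1r.
by rewrite e ipDD// !e1// (ipC (fun x => -1 * b x) b) e1//; ring.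
Qed.

Lemma ip_le_half a b : sqint t a -> sqint t b ->
  ip t a b <= (ip t a a + ip t b b) / 2.
Proof.
move=> ha hb; have := ip_ge0 (fun x => a x - b x).
by rewrite ipBB//; lra.
Qed.

Lemma ip_sub_le a b : sqint t a -> sqint t b ->
  ip t (fun x => a x - b x) (fun x => a x - b x) <= 2 * ip t a a + 2 * ip t b b.
Proof.
move=> ha hb; have := ip_ge0 (fun x => a x + b x).
by rewrite ipBB// ipDD//; lra.
Qed.

Lemma ip_add_le a b : sqint t a -> sqint t b ->
  ip t (fun x => a x + b x) (fun x => a x + b x) <= 2 * ip t a a + 2 * ip t b b.
Proof.
move=> ha hb; have := ip_ge0 (fun x => a x - b x).
by rewrite ipBB// ipDD//; lra.
Qed.

(* Test the hypothesis on psi = F / (2 C). *)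
Lemma ip_le_of_test (F : R -> R) (P C : R) : 0 < C -> sqint t F ->
  (forall psi, sqint t psi -> ip t F psi <= C * (P + ip t psi psi)) ->
  ip t F F <= 4 * C ^+ 2 * P.
Proof.
move=> C0 hF h; have hk := sqintZ (2 * C)^-1 hF.
have := h _ hk; rewrite ipC !ipZl// [ip t F (fun x => _ * _)]ipC ipZl//.
set N := ip t F F => FF.
have e : (2 * C)^-1 * N - C * ((2 * C)^-1 * ((2 * C)^-1 * N)) = N / (4 * C).
  by field; rewrite gt_eqF.
have : N / (4 * C) <= C * P by rewrite -e; move: FF; rewrite mulrDr; lra.
rewrite ler_pdivrMr ?mulr_gt0// => /le_trans; apply.
by rewrite expr2 le_eqVlt; apply/orP; left; apply/eqP; ring.
Qed.

Lemma sqenergy_ge0 F : (0 <= sqenergy t F)%E.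
Proof.
by apply: integral_ge0 => x _; rewrite mule_ge0 ?lee_fin// expe_ge0.
Qed.

Lemma sqenergyE a : sqenergy t (EFin \o a) = (\int[mu]_x (a x ^+ 2 * t x)%:E)%E.
Proof.
by apply: eq_integral => x _ /=; rewrite ?expe2 -!EFinM -expr2 real_normK ?num_real.
Qed.

Lemma sqintP a : measurable_fun [set: R] a ->
  sqint t a <-> (sqenergy t (EFin \o a) < +oo)%E.
Proof.
move=> ma.
have e : (\int[mu]_x `|(a x ^+ 2 * t x)%:E|)%E = sqenergy t (EFin \o a).
  rewrite sqenergyE; apply: eq_integral => x _ /=.
  by rewrite ger0_norm// mulr_ge0// sqr_ge0.
split; first by case=> _ /integrableP[_]; rewrite /= e.
move=> h; split => //; apply/integrableP; split; last by rewrite /= e.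
apply/measurable_EFinP; apply: measurable_funM => //.
exact: measurable_funX.
Qed.

Lemma sqenergy_ip a : sqint t a -> sqenergy t (EFin \o a) = (ip t a a)%:E.
Proof.
move=> ha; have [_ ia] := ha.
rewrite sqenergyE /ip /Rintegral fineK; first by apply: eq_integral => x _; rewrite expr2.
exact: integrable_fin_num (sqint_integrable ha ha).
Qed.

Lemma inL2P a : inL2 t a <-> sqint t a.
Proof.
rewrite /inL2 /L2norm -/(sqenergy t _); split.
  move=> [ma h]; apply/sqintP => //; apply: lty_poweRy h.
  by rewrite invr_eq0 pnatr_eq0.
move=> ha; split; first by case: ha.
by rewrite sqenergy_ip// poweR_EFin ltry.
Qed.

End FixedWeight.

Lemma L2normE t F : (forall x, 0 <= t x) -> L2norm t F = sqrte (sqenergy t F).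
Proof. by move=> t0; rewrite /L2norm poweR12_sqrt// sqenergy_ge0. Qed.

Lemma L2norm_le t t' F G (k : R) :
  (forall x, 0 <= t x) -> (forall x, 0 <= t' x) -> 0 <= k ->
  (L2norm t F <= k%:E * L2norm t' G)%E =
  (sqenergy t F <= (k ^+ 2)%:E * sqenergy t' G)%E.
Proof.
move=> t0 t'0 k0; rewrite !L2normE//.
have -> : k%:E = sqrte (k ^+ 2)%:E by rewrite /= sqrtr_sqr ger0_norm.
by rewrite -sqrteM ?lee_sqrt ?mule_ge0 ?sqenergy_ge0 ?lee_fin ?sqr_ge0.
Qed.

Lemma bounded_L2P t t' (T : (R -> R) -> R -> \bar R) :
  measurable_fun [set: R] t ->
  (forall x, 0 <= t x) -> (forall x, 0 <= t' x) ->
  bounded_L2 t t' T <-> exists2 C : R, 0 < C &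
    forall f, sqint t f -> (sqenergy t' (T f) <= (C * ip t f f)%:E)%E.
Proof.
move=> mt t0 t'0; split=> -[C C0 h].
  exists (C ^+ 2); first exact: exprn_gt0.
  move=> f ft; have := h _ ((inL2P mt t0 f).2 ft).
  by rewrite L2norm_le ?(ltW C0)// sqenergy_ip.
exists (Num.sqrt C); first by rewrite sqrtr_gt0.
move=> f /(inL2P mt t0) ft.
by rewrite L2norm_le ?sqrtr_ge0// sqr_sqrtr ?(ltW C0)// sqenergy_ip//; exact: h.
Qed.

End WeightedL2.

(** * Integrals over dyadic intervals *)

Section DyadicIntegrals.
Variable R : realType.
Local Notation mu := (@lebesgue_measure R).
Local Notation dint := (@dint R).
Local Notation dlen := (@dlen R).
Implicit Types (s r w g phi psi : R -> R) (I J K : dyadic).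

Lemma dlen_gt0 I : 0 < dlen I.
Proof. by rewrite /dlen exprz_gt0. Qed.

Lemma dlen_half I J : J.1 = I.1 + 1 -> dlen I = 2 * dlen J.
Proof.
rewrite /dlen => ->; rewrite opprD expfzDr ?pnatr_eq0//.
by rewrite mulrC -mulrA (_ : (2:R) ^ (-1) = 2^-1)// mulVf ?mulr1 ?pnatr_eq0.
Qed.

Lemma dintE I : dint I = `[I.2%:~R * dlen I, (I.2 + 1)%:~R * dlen I[%classic.
Proof. by rewrite set_itvE. Qed.

Lemma measurable_dint I : measurable (dint I : set (measurableTypeR R)).
Proof. by rewrite dintE; exact: measurable_itv. Qed.
Hint Resolve measurable_dint : core.

Lemma dint_measure I : mu (dint I) = (dlen I)%:E.
Proof.
rewrite dintE lebesgue_measure_itv /= lte_fin intrD mulrDl mul1r.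
by rewrite ltrDl dlen_gt0 -EFinD addrC addKr.
Qed.

Lemma dint_lhalf I : dint (lhalf I) =
  [set x | I.2%:~R * dlen I <= x < (I.2%:~R + 2^-1) * dlen I].
Proof.
rewrite /Defs.dint (@dlen_half I (lhalf I))// /lhalf /= !intrD !intrM.
by apply/seteqP; split => x /=; set d := Defs.dlen _ _ => /andP[h1 h2];
  apply/andP; split; lra.
Qed.

Lemma dint_rhalf I : dint (rhalf I) =
  [set x | (I.2%:~R + 2^-1) * dlen I <= x < (I.2 + 1)%:~R * dlen I].
Proof.
rewrite /Defs.dint (@dlen_half I (rhalf I))// /rhalf /= !intrD !intrM.
by apply/seteqP; split => x /=; set d := Defs.dlen _ _ => /andP[h1 h2];
  apply/andP; split; lra.
Qed.

Lemma dint_halves I : dint I = dint (lhalf I) `|` dint (rhalf I).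
Proof.
rewrite dint_lhalf dint_rhalf /Defs.dint intrD; have d0 := dlen_gt0 I.
apply/seteqP; split => x /=.
  move=> /andP[h1 h2]; case: (ltP x ((I.2%:~R + 2^-1) * dlen I)) => h.
    by left; rewrite h1.
  by right.
by case=> /andP[h1 h2]; apply/andP; split; nra.
Qed.

Lemma dint_halves_disj I : [disjoint dint (lhalf I) & dint (rhalf I)].
Proof.
apply/eqP; rewrite dint_lhalf dint_rhalf; apply/seteqP; split => x //=.
by move=> [/andP[_ h1] /andP[h2 _]]; have := lt_le_trans h1 h2; rewrite ltxx.
Qed.

Lemma dint_lhalf_sub I : dint (lhalf I) `<=` dint I.
Proof. by rewrite [X in _ `<=` X]dint_halves; left. Qed.

Lemma dint_rhalf_sub I : dint (rhalf I) `<=` dint I.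
Proof. by rewrite [X in _ `<=` X]dint_halves; right. Qed.

Lemma tree_dint n J K : K \in tree n J -> dint K `<=` dint J.
Proof.
elim: n J => // n IHn J; rewrite inE mem_cat => /or3P[/eqP -> //|/IHn|/IHn] h.
- exact: subset_trans h (@dint_lhalf_sub J).
- exact: subset_trans h (@dint_rhalf_sub J).
Qed.

Lemma roots_disj j : [disjoint dint (j, 0) & dint (j, -1)].
Proof.
apply/eqP; rewrite /Defs.dint; apply/seteqP; split => x //=.
rewrite addNr !mul0r => -[/andP[h1 _] /andP[_ h2]].
by have := lt_le_trans h2 h1; rewrite ltxx.
Qed.

(** The form of local integrability shared by the weights and by the elements of L^2(1/s). *)
Definition dintegrable g := measurable_fun [set: R] g /\
  forall I, mu.-integrable (dint I) (EFin \o g).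

Definition mass g I : R := \int[mu]_(x in dint I) g x.

Lemma avgE g I : avg g I = mass g I / dlen I.
Proof. by rewrite /avg mulrC. Qed.

Lemma locally_integrable_dintegrable g :
  locally_integrable [set: R] g -> dintegrable g.
Proof.
move=> [mg _ hg]; split=> // I.
apply: (@integrableS _ _ _ mu `[I.2%:~R * dlen I, (I.2 + 1)%:~R * dlen I]%classic).
- exact: measurable_itv.
- exact: measurable_dint.
- by rewrite dintE; apply: subset_itvl; rewrite bnd_simp.
- apply/integrableP; split.
    by apply/measurable_EFinP; apply: measurable_funS mg.
  by apply: hg => //; exact: segment_compact.
Qed.

Lemma mass_additive g : dintegrable g -> dyadic_additive (mass g).
Proof.
move=> [_ hg] K; rewrite /mass {1}dint_halves Rintegral_setU//.
- by rewrite -dint_halves.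
- exact: dint_halves_disj.
Qed.

Lemma mass_ge0 g I : (forall x, 0 <= g x) -> 0 <= mass g I.
Proof. by move=> g0; apply: Rintegral_ge0. Qed.

Lemma mass_gt0 g I : dintegrable g -> (forall x, 0 < g x) -> 0 < mass g I.
Proof.
move=> [mg hg] g0; rewrite lt_neqAle mass_ge0 ?andbT; last by move=> x; exact: ltW.
apply/negP => /eqP /esym e0.
have : (\int[mu]_(x in dint I) `|(g x)%:E|)%E = 0%E.
  under eq_integral do rewrite /= ger0_norm ?(ltW (g0 _))//.
  have := integrable_fin_num (measurable_dint I) (hg I).
  by move=> /fineK <-; rewrite -[fine _]/(mass g I) e0.
have mI : measurable_fun (dint I) (EFin \o g).
  by apply/measurable_EFinP; apply: measurable_funS mg.
move/(ae_eq_integral_abs mu (measurable_dint I) mI) => -[N [mN N0 sub]].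
have : (mu (dint I) <= mu N)%E.
  apply: le_measure; rewrite ?inE// => x Ix; apply: sub => /= /(_ Ix).
  by case=> e; have := g0 x; rewrite e ltxx.
by rewrite N0 dint_measure lee_fin leNgt dlen_gt0.
Qed.

Lemma dint_indicE g I x : (g \_ (dint I)) x = \1_(dint I) x * g x.
Proof. by rewrite patchE indicE; case: ifPn => _; rewrite ?mul1r ?mul0r. Qed.

Lemma integrable_indic_mul g I : dintegrable g ->
  mu.-integrable [set: R] (EFin \o (fun x => \1_(dint I) x * g x)).
Proof.
move=> [mg hg]; have := (integrable_mkcond _ (measurable_dint I)).1 (hg I).
apply: eq_integrable => // x _ /=.
by rewrite restrict_EFin /= dint_indicE.
Qed.

Lemma integral_indic_mul g I :
  \int[mu]_x (\1_(dint I) x * g x) = mass g I.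
Proof.
rewrite /mass [RHS]Rintegral_mkcond; apply: eq_Rintegral => x _.
by rewrite dint_indicE.
Qed.

Lemma haarE I x : haar I x = (Num.sqrt (dlen I))^-1 * \1_(dint (rhalf I)) x
  - (Num.sqrt (dlen I))^-1 * \1_(dint (lhalf I)) x.
Proof. by rewrite /haar mulrBr. Qed.

Lemma pairing_haar g I : dintegrable g ->
  pairing g (haar I) = (Num.sqrt (dlen I))^-1 * jump (mass g) I.
Proof.
move=> hg; rewrite /pairing.
have e x : g x * haar I x = (Num.sqrt (dlen I))^-1 * (\1_(dint (rhalf I)) x * g x)
    - (Num.sqrt (dlen I))^-1 * (\1_(dint (lhalf I)) x * g x).
  by rewrite haarE; ring.
under eq_Rintegral do rewrite e.
have h J := integrable_indic_mul J hg.
have hz J := integrableZl measurableT (Num.sqrt (dlen I))^-1 (h J).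
rewrite RintegralB//; [|exact: hz|exact: hz].
by rewrite !RintegralZl// !integral_indic_mul /jump mulrBr.
Qed.

(** Inversion is continuous only off 0, so the zeros of g are first moved to 1; the convention 0^-1
    = 0 puts them back afterwards. *)
Lemma measurable_funV g : measurable_fun [set: R] g ->
  measurable_fun [set: R] (fun x => (g x)^-1).
Proof.
move=> mg; pose h x := if g x == 0 then 1 else g x.
have mg0 : measurable_fun [set: R] (fun x => g x == 0).
  by apply: measurable_fun_eqr => //; exact: measurable_cst.
have mh : measurable_fun [set: R] (fun x => (h x)^-1).
  apply: (@measurable_comp _ _ _ _ _ _ [set x : R | x != 0] _ _ h) => //.
  - exact: open_measurable.
  - by move=> _ [x _ <-] /=; rewrite /h; case: (eqVneq (g x) 0) => [_|//]; exact: oner_neq0.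
  - apply: open_continuous_measurable_fun => // x; rewrite inE/= => x0.
    exact: inv_continuous.
  - by apply: measurable_fun_ifT.
rewrite (_ : (fun x => _) = fun x => if g x == 0 then 0 else (h x)^-1).
  by apply: measurable_fun_ifT.
by apply/funext => x; rewrite /h; case: eqP => [->|//]; rewrite invr0.
Qed.

Section TestFunctions.
Variable s : R -> R.
Hypotheses (hs : dintegrable s) (s0 : forall x, 0 < s x).
Local Notation t := (fun x => (s x)^-1).

Lemma inv_ge0 x : 0 <= t x.
Proof. by rewrite invr_ge0 ltW. Qed.

Lemma measurable_inv : measurable_fun [set: R] t.
Proof. by apply: measurable_funV; case: hs. Qed.

Lemma sqint_indic I : sqint t (fun x => \1_(dint I) x * s x).
Proof.
split; first by apply: measurable_funM; [exact: (measurable_indic (measurable_dint I))|case: hs].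
have := integrable_indic_mul I hs; apply: eq_integrable => // x _ /=.
rewrite indicE; case: (x \in _) => /=; rewrite ?mul0r ?expr0n ?mul0r// !mul1r.
by rewrite expr2 mulfK// gt_eqF.
Qed.

Lemma ip_indic phi I :
  ip t phi (fun x => \1_(dint I) x * s x) = mass phi I.
Proof.
rewrite -integral_indic_mul; apply: eq_Rintegral => x _.
by rewrite mulrA mulfK ?gt_eqF// mulrC.
Qed.

(** On I, phi is the product of phi, 1_I s and 1/s, and 1_I s lies in L^2(1/s) because s is
    integrable on I. *)
Lemma sqint_dintegrable phi : sqint t phi -> dintegrable phi.
Proof.
move=> hphi; split; first by case: hphi.
move=> I; have mt := measurable_inv.
have := sqint_integrable mt inv_ge0 hphi (sqint_indic I).
move=> h; apply/(integrable_mkcond _ (measurable_dint I)).2.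
apply: eq_integrable h => // x _ /=.
by rewrite restrict_EFin /= dint_indicE mulrA mulfK ?gt_eqF// mulrC.
Qed.

Lemma haar_testE I : (fun x => haar I x * s x) =
  (fun x => (Num.sqrt (dlen I))^-1 * (\1_(dint (rhalf I)) x * s x)
   + - (Num.sqrt (dlen I))^-1 * (\1_(dint (lhalf I)) x * s x)).
Proof. by apply/funext => x; rewrite haarE; ring. Qed.

Lemma sqint_haar I : sqint t (fun x => haar I x * s x).
Proof.
rewrite haar_testE; apply: sqintD; rewrite ?inv_ge0//; try exact: measurable_inv.
- by move=> x; exact: inv_ge0.
- by apply: sqintZ; exact: sqint_indic.
- by apply: sqintZ; exact: sqint_indic.
Qed.

Lemma ip_haar phi I :
  ip t phi (fun x => haar I x * s x) = pairing phi (haar I).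
Proof.
by apply: eq_Rintegral => x _; rewrite mulrA mulfK// gt_eqF.
Qed.

Lemma energy_bound_mass phi : sqint t phi ->
  energy_bound (mass s) (mass phi) (ip t phi phi).
Proof.
move=> hphi; have dphi := sqint_dintegrable hphi.
have iE := sqint_integrable measurable_inv inv_ge0 hphi hphi.
have dE : dintegrable (fun x => phi x * phi x * t x).
  split; first by apply/measurable_EFinP; exact: (measurable_int mu iE).
  by move=> I; apply: integrableS iE.
exists (mass (fun x => phi x * phi x * t x)); first exact: mass_additive.
split=> [K|j]; last first.
  rewrite /mass -Rintegral_setU//; last 2 first.
  - by apply: integrableS iE => //; exact: measurableU.
  - exact: roots_disj.
  rewrite /ip /Rintegral; apply: fine_le.
  - by apply: integrable_fin_num; [exact: measurableU|apply: integrableS iE => //; exact: measurableU].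
  - exact: integrable_fin_num iE.
  - apply: ge0_subset_integral => //; first exact: measurableU.
      exact: (measurable_int mu iE).
    by move=> x _; rewrite lee_fin -expr2 mulr_ge0 ?sqr_ge0 ?inv_ge0.
have sK := mass_gt0 K hs s0.
(* This c minimizes the integral of (phi - c s)^2 / s over K, and nonnegativity of the minimum is
   Cauchy-Schwarz. *)
pose c := mass phi K / mass s K.
have : 0 <= \int[mu]_(x in dint K)
    ((phi x * phi x * t x + - (2 * c) * phi x) + c ^+ 2 * s x).
  apply: Rintegral_ge0 => x _.
  have -> : (phi x * phi x * t x + - (2 * c) * phi x) + c ^+ 2 * s x
     = (phi x - c * s x) ^+ 2 * t x by field; rewrite gt_eqF.
  by rewrite mulr_ge0 ?sqr_ge0 ?inv_ge0.
have i1 := dE.2 K; have i2 := dphi.2 K; have i3 := hs.2 K.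
have mK := measurable_dint K.
have z2 := integrableZl mK (- (2 * c)) i2; have z3 := integrableZl mK (c ^+ 2) i3.
rewrite RintegralD//; last by exact: (integrableD mK i1 z2).
rewrite RintegralD// !RintegralZl// -!/(mass _ K).
set E := mass _ K; have -> : E + - (2 * c) * mass phi K + c ^+ 2 * mass s K
  = (mass s K * E - mass phi K ^+ 2) / mass s K.
  by rewrite /c; field; rewrite gt_eqF.
by rewrite pmulr_lge0 ?invr_gt0// subr_ge0.
Qed.

End TestFunctions.

End DyadicIntegrals.

(** * Completeness and unconditional sums *)

Section Completeness.
Variable R : realType.
Local Notation mu := (@lebesgue_measure R).
Variable t : R -> R.
Hypotheses (mt : measurable_fun [set: R] t) (t0 : forall x, 0 < t x).
Let t0' x : 0 <= t x := ltW (t0 x).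
Implicit Types (F : nat -> R -> R) (g a : R -> R).

Local Notation q n := ((2^-1 : R) ^+ n).

Lemma sum_half_le n : \sum_(0 <= k < n) q k <= 2.
Proof.
have := @geometric_le_lim R n 1 2^-1 ler01.
rewrite (_ : 1 * (1 - 2^-1)^-1 = 2 :> R); last first.
  by rewrite mul1r (_ : 1 - 2^-1 = 2^-1) ?invrK//; lra.
rewrite seriesEnat /= => h.
rewrite (eq_bigr (geometric 1 2^-1)); last by move=> i _; rewrite /= mul1r.
by apply: h; rewrite ?invr_gt0// ger0_norm ?invr_ge0//; lra.
Qed.

(* |D_n| <= (2^-n + 2^n D_n^2) / 2 makes the telescoping series converge
   absolutely wherever the sum of 2^n D_n^2 is finite. *)
Lemma riesz_fischer F : (forall n, sqint t (F n)) ->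
  (forall n, ip t (fun x => F n.+1 x - F n x) (fun x => F n.+1 x - F n x)
     <= q n ^+ 2) ->
  exists2 g : R -> R, measurable_fun [set: R] g &
    {ae mu, forall x, F n x @[n --> \oo] --> g x}.
Proof.
move=> sF hF.
pose D n x := F n.+1 x - F n x.
have sD n : sqint t (D n).
  have := sqintD mt t0' (sF n.+1) (sqintZ (-1) (sF n)).
  by rewrite (_ : (fun x => _) = D n)//; apply/funext => x; rewrite /D mulN1r.
(* The energy of D_n is at most 4^-n, so even with the weight 2^n its integral is at most 2^-n,
   which is summable. *)
pose h n x := ((q n)^-1 * (D n x ^+ 2 * t x))%:E.
have h0 n x : (0 <= h n x)%E.
  rewrite lee_fin mulr_ge0 ?invr_ge0 ?exprn_ge0 ?invr_ge0//.
  exact: mulr_ge0 (sqr_ge0 _) (t0' x).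
have mh n : measurable_fun [set: R] (h n).
  have [mD _] := sD n; apply/measurable_EFinP.
  apply: measurable_funM; first exact: measurable_cst.
  by apply: measurable_funM => //; exact: measurable_funX.
have ih n : (\int[mu]_x h n x <= (q n)%:E)%E.
  have q0 : 0 < q n by rewrite exprn_gt0 ?invr_gt0.
  have iD : (\int[mu]_x (D n x ^+ 2 * t x)%:E = (ip t (D n) (D n))%:E)%E.
    by rewrite -sqenergyE// sqenergy_ip.
  have -> : (\int[mu]_x h n x = ((q n)^-1 * ip t (D n) (D n))%:E)%E.
    rewrite EFinM -iD -ge0_integralZl//.
    - apply/measurable_EFinP; apply: measurable_funM => //.
      by apply: measurable_funX; case: (sD n).
    - by move=> x _; rewrite lee_fin; exact: mulr_ge0 (sqr_ge0 _) (t0' x).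
  by rewrite lee_fin mulrC ler_pdivrMr// -expr2; exact: hF.
have iH : (\int[mu]_x (\sum_(n <oo) h n x) <= 2%:E)%E.
  rewrite integral_nneseries//; apply: lime_le.
    by apply: is_cvg_nneseries => n _ _; exact: integral_ge0.
  apply: nearW => n; apply: (@le_trans _ _ (\sum_(0 <= k < n) (q k)%:E)%E).
    by apply: lee_sum => k _; exact: ih.
  by rewrite sumEFin lee_fin sum_half_le.
have mH : measurable_fun [set: R] (fun x => \sum_(n <oo) h n x)%E.
  by apply: ge0_emeasurable_sum => // n; exact: mh.
have intH : mu.-integrable [set: R] (fun x => \sum_(n <oo) h n x)%E.
  apply/integrableP; split=> //.
  under eq_integral do rewrite gee0_abs ?nneseries_ge0//.
  exact: le_lt_trans iH (ltry _).
(* The upper limit is measurable and defined everywhere, and it agrees with the limit wherever that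
   exists. *)
exists (fun x => fine (limn_esup (fun n => (F n x)%:E))).
  apply: (@measurableT_comp _ _ _ _ _ _ fine); first exact: fine_measurable.
  apply: measurable_fun_limn_esup => n.
  by apply/measurable_EFinP; case: (sF n).
apply: filterS (integrable_ae measurableT intH) => x /(_ I) fx.
pose S := fine (\sum_(n <oo) h n x).
have hS n : \sum_(0 <= k < n) (q k)^-1 * D k x ^+ 2 <= S / t x.
  rewrite ler_pdivlMr// mulr_suml -lee_fin /S fineK// -sumEFin.
  apply: (@le_trans _ _ (\sum_(0 <= k < n) h k x)%E).
    by apply: lee_sum => k _; rewrite /h lee_fin -mulrA lexx.
  exact: nneseries_lim_ge.
have cD : cvgn (series (fun n => D n x)).
  apply: normed_cvg; apply: nondecreasing_is_cvgn.
    by apply: nondecreasing_series => n _ _ /=; exact: normr_ge0.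
  exists ((2 + S / t x) / 2) => _ [n _ <-].
  rewrite /normed_series_of seriesEnat /= (@le_trans _ _
    ((\sum_(0 <= k < n) q k + \sum_(0 <= k < n) (q k)^-1 * D k x ^+ 2) / 2))//.
    rewrite -big_split /= mulr_suml; apply: ler_sum => k _.
    have qk : 0 < (q k)^-1 by rewrite invr_gt0 exprn_gt0 ?invr_gt0.
    have := @ler_norm_mul _ 1 (D k x) (q k)^-1 qk.
    by rewrite mul1r expr1n invrK mul1r [_ * (q k)^-1]mulrC.
  by rewrite ler_pM2r ?invr_gt0// lerD// sum_half_le.
have cF : cvgn (fun n => F n x : R^o).
  have -> : (fun n => F n x) = (fun n => F 0%N x + series (fun n => D n x) n).
    by apply/funext => n; rewrite seriesEnat /= /D telescope_sumr// addrC subrK.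
  by apply: is_cvgD => //; exact: is_cvg_cst.
have := cF => /cvg_ex[l Fl].
have -> : fine (limn_esup (fun n => (F n x)%:E)) = l.
  have /cvg_limn_einf_sup[_ ->]// : (fun n => (F n x)%:E) @ \oo --> l%:E.
  by apply/cvg_EFin; [exact: nearW|exact: Fl].
exact: Fl.
Qed.

(** Subtracting a serves two purposes: a = 0 bounds the norm of the limit, and a equal to a partial
    sum bounds the distance to it. *)
Lemma fatou_sqint F g a (c : R) : (forall n, sqint t (F n)) ->
  measurable_fun [set: R] g -> sqint t a ->
  {ae mu, forall x, F n x @[n --> \oo] --> g x} ->
  (forall n, ip t (fun x => F n x - a x) (fun x => F n x - a x) <= c) ->
  sqint t (fun x => g x - a x) /\
  ip t (fun x => g x - a x) (fun x => g x - a x) <= c.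
Proof.
move=> sF mg sa Fg hc.
have [ma _] := sa.
have mga : measurable_fun [set: R] (fun x => g x - a x).
  exact: measurable_funB.
pose f n x := ((F n x - a x) ^+ 2 * t x)%:E.
have mf n : measurable_fun [set: R] (f n).
  apply/measurable_EFinP; apply: measurable_funM => //; apply: measurable_funX.
  by apply: measurable_funB => //; case: (sF n).
have f0 n x : (0 <= f n x)%E.
  by rewrite lee_fin; exact: mulr_ge0 (sqr_ge0 _) (t0' x).
have sD n : sqint t (fun x => F n x - a x).
  have := sqintD mt t0' (sF n) (sqintZ (-1) sa).
  by rewrite (_ : (fun x => _) = (fun x => F n x - a x))//;
    apply/funext => x; rewrite mulN1r.
have e : (sqenergy t (EFin \o (fun x => g x - a x)%R) =
    \int[mu]_x limn_einf (f ^~ x))%E.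
  rewrite sqenergyE//; apply: ge0_ae_eq_integral => //.
  - apply/measurable_EFinP; apply: measurable_funM => //.
    exact: measurable_funX.
  - apply: (@measurableT_comp _ _ _ _ _ _ (@oppe R)); first exact: oppe_measurable.
    by apply: measurable_fun_limn_esup => n; apply: (@measurableT_comp _ _ _ _ _ _ (@oppe R)); [exact: oppe_measurable|exact: mf].
  - by move=> x _; rewrite lee_fin; exact: mulr_ge0 (sqr_ge0 _) (t0' x).
  - move=> x _; rewrite limn_einf_lim; apply: lime_ge; first exact: is_cvg_einfs.
    by apply: nearW => n; apply: le_ereal_inf_tmp => _ [m _ <-].
  apply: (@filterS _ (almost_everywhere mu) _ _ _ _ Fg) => x {}Fg _.
  have /cvg_limn_einf_sup[-> _]// : f n x @[n --> \oo] --> ((g x - a x) ^+ 2 * t x)%:E.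
  apply/cvg_EFin; first exact: nearW.
  apply: cvgM; last exact: cvg_cst.
  by rewrite /= expr2; apply: cvgM; apply: cvgB => //; exact: cvg_cst.
have le_c : (sqenergy t (EFin \o (fun x => g x - a x)%R) <= c%:E)%E.
  rewrite e; apply: le_trans (fatou mu measurableT mf (fun n x _ => f0 n x)) _.
  rewrite limn_einf_lim; apply: lime_le; first exact: is_cvg_einfs.
  apply: nearW => n.
  apply: (@le_trans _ _ (\int[mu]_x f n x)%E).
    by apply: ereal_inf_lbound; exists n => /=.
  by rewrite -[X in (X <= _)%E]sqenergyE// sqenergy_ip// lee_fin.
have s : sqint t (fun x => g x - a x).
  by apply/(sqintP mt t0') => //; exact: le_lt_trans le_c (ltry _).
by split => //; rewrite -lee_fin -sqenergy_ip.
Qed.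

End Completeness.

(** * Unconditional convergence from uniformly bounded signed sums *)

Section UnconditionalSums.
Variable R : realType.
Local Notation mu := (@lebesgue_measure R).
Variables (T : eqType) (t : R -> R) (e : T -> R -> R).
Hypotheses (mt : measurable_fun [set: R] t) (t0 : forall x, 0 < t x).
Hypothesis se : forall i, sqint t (e i).
Let t0' x : 0 <= t x := ltW (t0 x).

Definition signed (eps : T -> R) := forall i, eps i = 1 \/ eps i = -1.

Definition partial (eps : T -> R) (A : seq T) (x : R) : R :=
  \sum_(i <- A) eps i * e i x.

Lemma sqint_partial eps A : sqint t (partial eps A).
Proof. by apply: sqint_sum => // i; exact: sqintZ. Qed.

Lemma partial_cat eps A B x :
  partial eps (A ++ B) x = partial eps A x + partial eps B x.
Proof. exact: big_cat. Qed.

(* Choosing the signs one at a time makes every cross term nonnegative. *)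
Lemma sign_choice A : uniq A -> exists2 eps, signed eps &
  \sum_(i <- A) ip t (e i) (e i) <= ip t (partial eps A) (partial eps A).
Proof.
elim: A => [_|i A IHA /= /andP[iA uA]].
  by exists (fun=> 1); [left|rewrite big_nil ip_ge0].
have [eps seps le_eps] := IHA uA.
pose c := ip t (e i) (partial eps A).
pose d : R := if 0 <= c then 1 else -1.
have dc : 0 <= d * c.
  by rewrite /d; case: ifP; rewrite ?mul1r// mulN1r oppr_ge0 => /negbT;
    rewrite -ltNge => /ltW.
exists (fun j => if j == i then d else eps j).
  by move=> j; case: ifP => // _; rewrite /d; case: ifP; [left|right].
have -> : partial (fun j => if j == i then d else eps j) (i :: A) =
    (fun x => d * e i x + partial eps A x).
  apply/funext => x; rewrite /partial big_cons eqxx; congr +%R.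
  by apply: eq_big_seq => j jA; case: eqP => // ji; rewrite -ji jA in iA.
have sP := sqint_partial eps A; have sd := sqintZ d (se i).
rewrite big_cons ipDD// !(ipZl mt t0' d (se i))// (ipC t (e i) (fun x => d * e i x)) (ipZl mt t0' d (se i))//.
rewrite -/c (_ : d * (d * _) = ip t (e i) (e i)); first by lra.
by rewrite mulrA /d; case: ifP => _; rewrite ?mulrNN !mul1r.
Qed.

Variable M : R.
Hypothesis hM : forall A eps, uniq A -> signed eps ->
  ip t (partial eps A) (partial eps A) <= M.

(* A nearly maximal signed sum F leaves room for no other: for disjoint G, one
   of F + G and F - G has at least the energy of F plus that of G. *)
Lemma small_tails eps (eta : R) : signed eps -> 0 < eta ->
  exists2 A, uniq A & forall B, uniq B -> ~~ has (mem A) B ->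
    ip t (partial eps B) (partial eps B) <= eta.
Proof.
move=> seps eta0.
pose S := [set ip t (partial p.1 p.2) (partial p.1 p.2) |
  p in [set p : (T -> R) * seq T | signed p.1 /\ uniq p.2]].
have Sub : has_ubound S by exists M => _ [p [sp up] <-]; exact: hM.
have Sne : S !=set0.
  by exists (ip t (partial eps [::]) (partial eps [::])), (eps, [::]).
have [_ [[d A] [/= sd uA] <-] hA] := @sup_adherent _ S _ eta0 (conj Sne Sub).
exists A => // B uB AB; have uAB : uniq (A ++ B) by rewrite cat_uniq uA AB.
pose glue (k : R) i := if i \in A then d i else k * eps i.
have glueE k : partial (glue k) (A ++ B) =
    (fun x => partial d A x + k * partial eps B x).
  apply/funext => x; rewrite partial_cat; congr +%R.
    by apply: eq_big_seq => i iA; rewrite /glue iA.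
  rewrite mulr_sumr; apply: eq_big_seq => i iB; rewrite /glue mulrA ifN//.
  by apply: contra AB => iA; apply/hasP; exists i.
have le_sup k : k = 1 \/ k = -1 ->
    ip t (partial (glue k) (A ++ B)) (partial (glue k) (A ++ B)) <= sup S.
  move=> hk; apply: ub_le_sup => //; exists (glue k, A ++ B) => //; split => //.
  move=> i /=; rewrite /glue; case: ifP => // _.
  by case: hk => ->; rewrite ?mul1r// mulN1r; case: (seps i) => ->; rewrite ?opprK; [right|left].
have sP := sqint_partial d A; have sB := sqint_partial eps B.
have := le_sup 1 (or_introl erefl); have := le_sup (-1) (or_intror erefl).
have eqk k : ip t (partial (glue k) (A ++ B)) (partial (glue k) (A ++ B))
   = ip t (partial d A) (partial d A) + 2 * (k * ip t (partial d A) (partial eps B))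
     + k ^+ 2 * ip t (partial eps B) (partial eps B).
  have sk := sqintZ k sB.
  have z := ipZl mt t0' k sB; have e1 c : sqint t c ->
      ip t c (fun x => k * partial eps B x) = k * ip t c (partial eps B).
    by move=> sc; rewrite ipC z// ipC.
  by rewrite glueE ipDD// !e1// z//; ring.
by rewrite !eqk; lra.
Qed.

(** Partial sums over an increasing sequence of sets with small tails form a fast Cauchy sequence.
    Any larger set differs from its members by two small tails only, so the limit is reached along
    all finite families. *)
Lemma unconditional_sum eps : signed eps -> exists2 g, sqint t g /\ ip t g g <= M &
  forall eta, 0 < eta -> exists2 A : seq T, uniq A &
    forall B, uniq B -> {subset A <= B} ->
      sqint t (fun x => g x - partial eps B x) /\
      ip t (fun x => g x - partial eps B x) (fun x => g x - partial eps B x) <= eta.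
Proof.
move=> seps.
pose eta n : R := (2^-1 ^+ n) ^+ 2.
have eta0 n : 0 < eta n by rewrite !exprn_gt0 ?invr_gt0.
have /choice[a ha] : forall n, exists A, uniq A /\ forall B, uniq B ->
    ~~ has (mem A) B -> ip t (partial eps B) (partial eps B) <= eta n.
  by move=> n; have [A uA hA] := small_tails seps (eta0 n); exists A.
pose A := fix A n := if n is n'.+1 then undup (a n ++ A n') else a 0%N.
have uA n : uniq (A n) by case: n => [|n]; [exact: (ha 0%N).1|exact: undup_uniq].
have aA n : {subset a n <= A n}.
  by case: n => // n i; rewrite mem_undup mem_cat => ->.
have AS n : {subset A n <= A n.+1}.
  by move=> i; rewrite mem_undup mem_cat orbC => ->.
have Amono n m : {subset A n <= A (m + n)%N}.
  by elim: m => // m IHm i /IHm; exact: AS.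
have tail n B : uniq B -> ~~ has (mem (A n)) B ->
    ip t (partial eps B) (partial eps B) <= eta n.
  move=> uB h; apply: (ha n).2 => //; apply: contra h => /hasP[i iB ia].
  by apply/hasP; exists i => //; exact: aA.
have diff n B C : uniq B -> uniq C -> {subset A n <= B} -> {subset A n <= C} ->
    ip t (fun x => partial eps B x - partial eps C x)
         (fun x => partial eps B x - partial eps C x) <= 4 * eta n.
  move=> uB uC AB AC.
  (* The common part of B and C cancels, and both remainders avoid [A n]. *)
  pose B' := [seq i <- B | i \notin C]; pose C' := [seq i <- C | i \notin B].
  have split x D (E : seq T) : partial eps D x =
      partial eps [seq i <- D | i \notin E] x + partial eps [seq i <- D | i \in E] x.
    by rewrite /partial !big_filter addrC (bigID (mem E)).
  have -> : (fun x => partial eps B x - partial eps C x) =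
      (fun x => partial eps B' x - partial eps C' x).
    apply/funext => x; rewrite (split x B C) (split x C B).
    rewrite [partial eps [seq i <- B | i \in C] x](perm_big [seq i <- C | i \in B]);
      first by rewrite -/(partial _ _ _); ring.
    apply: uniq_perm; rewrite ?filter_uniq// => i.
    by rewrite !mem_filter andbC.
  apply: le_trans (ip_sub_le mt t0' (sqint_partial _ _) (sqint_partial _ _)) _.
  have h1 : ip t (partial eps B') (partial eps B') <= eta n.
    apply: tail; first exact: filter_uniq.
    apply/hasPn => i; rewrite mem_filter => /andP[iC _].
    by apply: contra iC; exact: AC.
  have h2 : ip t (partial eps C') (partial eps C') <= eta n.
    apply: tail; first exact: filter_uniq.
    apply/hasPn => i; rewrite mem_filter => /andP[iC _].
    by apply: contra iC; exact: AB.
  by lra.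
(* The shift by one absorbs the factor 4 of [diff]: 4 * 4^-(n+1) = 4^-n. *)
pose F n := partial eps (A n.+1).
have sF n : sqint t (F n) by exact: sqint_partial.
have FS n : ip t (fun x => F n.+1 x - F n x) (fun x => F n.+1 x - F n x)
    <= (2^-1 ^+ n) ^+ 2.
  have := diff n.+1 _ _ (uA n.+2) (uA n.+1) (@AS n.+1) (fun _ h => h).
  move=> /le_trans; apply; rewrite /eta (exprS _ n) exprMn.
  by move: (2^-1 ^+ n) => x; lra.
have [g mg Fg] := riesz_fischer mt t0 sF FS.
exists g.
  have g0 : (fun x => g x - 0) = g by apply/funext => x; rewrite subr0.
  have := @fatou_sqint R t mt t0 F g (fun=> 0) M sF mg (sqint0 t) Fg.
  rewrite g0; apply=> n.
  rewrite (_ : (fun x => F n x - 0) = F n); last by apply/funext => x; rewrite subr0.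
  exact: hM.
move=> d d0.
have [n hn] : exists n, 4 * eta n <= d.
  have : 2^-1 ^+ n @[n --> \oo] --> (0 : R).
    by apply: cvg_expr; rewrite ger0_norm ?invr_ge0//; lra.
  have d40 : 0 < d / 4 by rewrite divr_gt0.
  move/cvgrPdist_lt => /(_ _ d40) [n _ /(_ n (leqnn n))] /=.
  rewrite sub0r normrN ger0_norm ?exprn_ge0 ?invr_ge0// => h; exists n.
  have q1 : 2^-1 ^+ n <= 1 :> R by rewrite exprn_ile1 ?invr_ge0//; lra.
  have q0 : 0 <= 2^-1 ^+ n :> R by rewrite exprn_ge0 ?invr_ge0.
  have := ler_wpM2l q0 q1; rewrite /eta expr2; lra.
exists (A n) => // B uB AB.
have := @fatou_sqint R t mt t0 (fun m => F (m + n)%N) g (partial eps B) d.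
apply => //.
- exact: sqint_partial.
- apply: (@filterS _ (almost_everywhere mu) _ _ _ _ Fg) => x Fx.
  by apply: (@cvg_comp _ _ _ (fun m => (m + n)%N) (fun m => F m x) _ _ _ _ Fx); exact: cvg_addnr.
- move=> m; apply: le_trans hn; apply: diff => // i /(@Amono n m) h.
  exact: AS.
Qed.

End UnconditionalSums.

(** * The bilinear forms *)

Section Forms.
Variable R : realType.
Local Notation dint := (@dint R).
Local Notation dlen := (@dlen R).
Implicit Types (s r w phi psi : R -> R) (I J K : dyadic) (A : seq dyadic).

(* L^2(s) is represented by phi = g s, whose squared norm is ip s^-1 phi phi. *)
Definition dual s := fun x => (s x)^-1.

(** The term of T_(w,sigma) without its sign, moved from L^2(v) to L^2(1/r) by the isometry that
    multiplies by r / w. *)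
Definition haar_term r w phi I x : R :=
  pairing phi (haar I) / avg w I * (haar I x * r x).

Definition sign_bounded s r w := exists2 C : R, 0 < C &
  forall A eps phi, uniq A -> signed eps -> sqint (dual s) phi ->
  ip (dual r) (partial (haar_term r w phi) eps A) (partial (haar_term r w phi) eps A)
    <= C * ip (dual s) phi phi.

(* By scaling phi and psi, the sum of the squared norms on the right is
   equivalent to the product of the norms. *)
Definition abs_bounded s r w := exists2 C : R, 0 < C &
  forall A phi psi, uniq A -> sqint (dual s) phi -> sqint (dual r) psi ->
  \sum_(K <- A) `|jump (mass phi) K * jump (mass psi) K| / mass w K
    <= C * (ip (dual s) phi phi + ip (dual r) psi psi).

(** The absolute value of A'_K B'_K / <w>_K in the notation of the overview; the lengths cancel. *)
Definition pos_term s r w phi psi K : R :=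
  `|jump (mass s) K * (mass phi K / mass s K) *
    (jump (mass r) K * (mass psi K / mass r K))| / mass w K.

Definition pos_bounded s r w := exists2 C : R, 0 < C &
  forall A phi psi, uniq A -> sqint (dual s) phi -> sqint (dual r) psi ->
  \sum_(K <- A) pos_term s r w phi psi K
    <= C * (ip (dual s) phi phi + ip (dual r) psi psi).

Definition jump_bounded s r w := exists2 C : R, 0 < C &
  forall A phi, uniq A -> sqint (dual s) phi ->
  \sum_(K <- A) jump_energy (mass w) (mass r) (mass phi) K
    <= C * ip (dual s) phi phi.

(** Positivity at every point makes cancelling a weight a pointwise identity; [posify] reduces the
    theorem to this case. *)
Definition admissible s := dintegrable s /\ forall x, 0 < s x.

(** The form is symmetric in its two functions. This duality yields the second jump bound in
    [sign_boundedP]. *)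
Lemma abs_bounded_sym s r w : abs_bounded s r w -> abs_bounded r s w.
Proof.
move=> [C C0 h]; exists C => // A phi psi uA hphi hpsi.
rewrite [X in C * X]addrC; apply: le_trans (h A psi phi uA hpsi hphi).
by rewrite le_eqVlt; apply/orP; left; apply/eqP; apply: eq_bigr => K _;
  rewrite mulrC [jump _ _ * _]mulrC mulrC.
Qed.

Section Equivalences.
Variables s r w : R -> R.
Hypotheses (hs : admissible s) (hr : admissible r) (hw : admissible w).
Let ds : dintegrable s := hs.1.
Let s0 : forall x, 0 < s x := hs.2.
Let dr : dintegrable r := hr.1.
Let r0 : forall x, 0 < r x := hr.2.
Let mtr : measurable_fun [set: R] (dual r) := measurable_inv dr.
Let tr0 x : 0 <= dual r x := inv_ge0 r0 x.
Let mts : measurable_fun [set: R] (dual s) := measurable_inv ds.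
Let ts0 x : 0 <= dual s x := inv_ge0 s0 x.
Let tr1 x : 0 < dual r x. Proof. by rewrite invr_gt0. Qed.
Let w0 K : 0 < mass w K := mass_gt0 K hw.1 hw.2.
Let ms0 K : 0 < mass s K := mass_gt0 K ds s0.
Let mr0 K : 0 < mass r K := mass_gt0 K dr r0.

Lemma sqint_haar_term phi I : sqint (dual r) (haar_term r w phi I).
Proof. by apply: sqintZ; exact: sqint_haar. Qed.

Lemma ip_haar_term phi psi I : dintegrable phi -> sqint (dual r) psi ->
  ip (dual r) (haar_term r w phi I) psi
  = jump (mass phi) I * jump (mass psi) I / mass w I.
Proof.
move=> dphi hpsi; have l0 := @dlen_gt0 R I; have w0I := w0 I.
rewrite (ipZl mtr tr0)//; last exact: sqint_haar.
rewrite ipC ip_haar// !pairing_haar//; last exact: (sqint_dintegrable dr r0 hpsi).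
rewrite avgE -[X in _ / (_ / X)](sqr_sqrtr (ltW l0)).
have : 0 < Num.sqrt (dlen I) by rewrite sqrtr_gt0.
by move: (Num.sqrt _) => m m0; field; rewrite !gt_eqF.
Qed.

Lemma ip_partial phi psi eps A : dintegrable phi -> sqint (dual r) psi ->
  ip (dual r) (partial (haar_term r w phi) eps A) psi
  = \sum_(I <- A) eps I * (jump (mass phi) I * jump (mass psi) I / mass w I).
Proof.
move=> dphi hpsi; rewrite ip_suml//; last first.
  by move=> I; apply: sqintZ; exact: sqint_haar_term.
apply: eq_bigr => I _; rewrite (ipZl mtr tr0)//; last exact: sqint_haar_term.
by rewrite ip_haar_term.
Qed.

Lemma ip_haar_haar I :
  ip (dual r) (fun x => haar I x * r x) (fun x => haar I x * r x) = avg r I.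
Proof.
rewrite ip_haar// avgE (mass_additive dr) /pairing.
have l0 := @dlen_gt0 R I.
have e x : haar I x * r x * haar I x = (dlen I)^-1 * (\1_(dint (lhalf I)) x * r x)
    + (dlen I)^-1 * (\1_(dint (rhalf I)) x * r x).
  have m2 : (dlen I)^-1 = (Num.sqrt (dlen I))^-1 ^+ 2.
    by rewrite exprVn sqr_sqrtr ?ltW.
  have d01 : \1_(dint (lhalf I)) x * \1_(dint (rhalf I)) x = 0 :> R.
    have /eqP := @dint_halves_disj R I => d.
    rewrite !indicE -natrM mulnb -in_setI d in_set0//.
  have i2 J : \1_(dint J) x ^+ 2 = \1_(dint J) x :> R.
    by rewrite indicE; case: (x \in _); rewrite ?expr1n ?expr0n.
  rewrite haarE m2 -[X in _ = _ * (X * _) + _]i2 -[X in _ = _ + _ * (X * _)]i2.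
  move: (Num.sqrt _)^-1 => m; move: d01.
  move: (\1_(dint (lhalf I)) x : R) (\1_(dint (rhalf I)) x : R) => a b ab.
  have -> : (m * b - m * a) * r x * (m * b - m * a) =
    m ^+ 2 * (a ^+ 2 * r x) + m ^+ 2 * (b ^+ 2 * r x) - 2 * m ^+ 2 * r x * (a * b).
    by ring.
  by rewrite ab mulr0 subr0.
under eq_Rintegral do rewrite e.
have i J := integrable_indic_mul J dr.
have z J := integrableZl measurableT (dlen I)^-1 (i J).
rewrite RintegralD//; [|exact: z|exact: z].
by rewrite !RintegralZl// !integral_indic_mul -mulrDr mulrC.
Qed.

Lemma jump_energyE phi I : dintegrable phi ->
  ip (dual r) (haar_term r w phi I) (haar_term r w phi I)
  = jump_energy (mass w) (mass r) (mass phi) I.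
Proof.
move=> dphi; have l0 := @dlen_gt0 R I; have w0I := w0 I.
have sh := sqint_haar dr r0 I.
rewrite (ipZl mtr tr0)//; last exact: sqint_haar_term.
rewrite ipC (ipZl mtr tr0)// ip_haar_haar pairing_haar// !avgE /jump_energy.
rewrite -[X in _ / (_ / X)](sqr_sqrtr (ltW l0)) -[X in _ * (_ / X)](sqr_sqrtr (ltW l0)).
have : 0 < Num.sqrt (dlen I) by rewrite sqrtr_gt0.
by move: (Num.sqrt _) => m m0; field; rewrite !gt_eqF.
Qed.

(** Each sign is taken equal to the sign of its term, so that nothing cancels when the sum is paired
    with psi. *)
Lemma sign_bounded_abs : sign_bounded s r w -> abs_bounded s r w.
Proof.
move=> [C C0 h]; exists (C + 1); first by rewrite addr_gt0.
move=> A phi psi uA hphi hpsi.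
pose c I := jump (mass phi) I * jump (mass psi) I.
pose eps I : R := if 0 <= c I then 1 else -1.
have seps : signed eps by move=> I; rewrite /eps; case: ifP; [left|right].
have dphi := sqint_dintegrable ds s0 hphi.
have hF : sqint (dual r) (partial (haar_term r w phi) eps A).
  exact: (sqint_partial mtr tr1 (sqint_haar_term phi)).
have -> : \sum_(K <- A) `|c K| / mass w K =
    ip (dual r) (partial (haar_term r w phi) eps A) psi.
  rewrite ip_partial//; apply: eq_bigr => I _; rewrite mulrA; congr (_ / _).
  rewrite /eps -/(c I); case: ifP => [c0|/negbT]; first by rewrite mul1r ger0_norm.
  by rewrite -ltNge mulN1r => c0; rewrite ltr0_norm.
apply: le_trans (ip_le_half mtr tr0 hF hpsi) _.
have := h A eps phi uA seps hphi.
have := ip_ge0 ts0 phi; have := ip_ge0 tr0 psi.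
have := mulr_ge0 (ltW C0) (ip_ge0 ts0 phi); have := mulr_ge0 (ltW C0) (ip_ge0 tr0 psi).
by rewrite mulrDr mulrDl mulrDl !mul1r; lra.
Qed.

Lemma abs_bounded_sign : abs_bounded s r w -> sign_bounded s r w.
Proof.
move=> [C C0 h]; exists (4 * C ^+ 2); first by rewrite mulr_gt0 ?exprn_gt0.
move=> A eps phi uA seps hphi.
have dphi := sqint_dintegrable ds s0 hphi.
set F := partial _ _ _.
have hF : sqint (dual r) F.
  exact: (sqint_partial mtr tr1 (sqint_haar_term phi)).
apply: (ip_le_of_test mtr tr0 C0 hF) => psi hpsi.
apply: le_trans (h A phi psi uA hphi hpsi).
rewrite ip_partial//; apply: ler_sum => I _.
rewrite mulrA ler_pM2r ?invr_gt0//; apply: le_trans (ler_norm _) _.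
by rewrite normrM; case: (seps I) => ->; rewrite ?normrN normr1 mul1r.
Qed.

(** The jump energies are the squared norms of the terms, and for the signs of [sign_choice] their
    sum is at most the squared norm of the signed sum. *)
Lemma sign_bounded_jump : sign_bounded s r w -> jump_bounded s r w.
Proof.
move=> [C C0 h]; exists C => // A phi uA hphi.
have dphi := sqint_dintegrable ds s0 hphi.
have [eps seps] := sign_choice mtr tr1 (sqint_haar_term phi) uA.
move=> /le_trans/(_ (h A eps phi uA seps hphi)); apply: le_trans.
by rewrite le_eqVlt; apply/orP; left; apply/eqP; apply: eq_bigr => I _;
  rewrite jump_energyE.
Qed.

Lemma mass_indic I J : (dint I `<=` dint J \/ [disjoint dint I & dint J]) ->
  mass (fun x => \1_(dint J) x * s x) I =
  if `[<dint I `<=` dint J>] then mass s I else 0.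
Proof.
case: asboolP => [IJ _|nIJ [//|/eqP d]].
  apply: eq_Rintegral => x; rewrite inE => Ix.
  by rewrite indicE mem_set ?mul1r//; exact: IJ.
rewrite /mass (@eq_Rintegral _ _ _ _ _ (cst 0)); last first.
  move=> x; rewrite inE => Ix; rewrite indicE memNset ?mul0r// => Jx.
  by have : (dint I `&` dint J) x by []; rewrite d.
by rewrite /Rintegral integral0.
Qed.

(** Test the single interval K on phi = 1_J s with J a half of K: the jump is s(J) up to sign and
    the squared norm is s(J). Adding the two halves gives the factor 2. *)
Lemma joint_A2 : jump_bounded s r w ->
  exists2 C : R, 0 < C & forall K, mass s K * mass r K <= C * mass w K ^+ 2.
Proof.
move=> [C C0 h]; exists (2 * C); first by rewrite mulr_gt0.
move=> K.
have key J : (jump (mass (fun x => \1_(dint J) x * s x)) K) ^+ 2 = mass s J ^+ 2 ->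
    mass s J * mass r K <= C * mass w K ^+ 2.
  move=> e; have := h [:: K] _ isT (sqint_indic ds s0 J).
  rewrite big_seq1 /jump_energy e ip_indic// mass_indic; last by left.
  rewrite asboolT// => hK.
  rewrite -(ler_pM2l (ms0 J)) mulrA -expr2 (mulrA (mass s J)) (mulrC _ C).
  by rewrite -ler_pdivrMr// exprn_gt0.
have disj : [disjoint dint (rhalf K) & dint (lhalf K)].
  by rewrite disj_set_sym; exact: dint_halves_disj.
have nsub (X Y : set R) : X !=set0 -> [disjoint X & Y] -> ~ (X `<=` Y).
  move=> [x Xx] /eqP d XY; have : (X `&` Y) x by split => //; exact: XY.
  by rewrite d.
have ne J : dint J !=set0.
  apply/set0P/negP => /eqP e; have := @dint_measure R J.
  by rewrite e measure0 => -[] /eqP; rewrite lt_eqF// dlen_gt0.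
have disj' := @dint_halves_disj R K.
have hl : mass s (lhalf K) * mass r K <= C * mass w K ^+ 2.
  apply: key; rewrite /jump (mass_indic (or_intror disj)).
  rewrite (mass_indic (or_introl (@subset_refl _ (dint (lhalf K))))).
  by rewrite (asboolF (nsub _ _ (ne _) disj)) asboolT// sub0r sqrrN.
have hrr : mass s (rhalf K) * mass r K <= C * mass w K ^+ 2.
  apply: key; rewrite /jump (mass_indic (or_intror disj')).
  rewrite (mass_indic (or_introl (@subset_refl _ (dint (rhalf K))))).
  by rewrite (asboolF (nsub _ _ (ne _) disj')) asboolT// subr0.
by rewrite (mass_additive ds K) mulrDl; lra.
Qed.

(** [bilinear_error] is summed over A: of its four terms, two are Bessel sums and two are jump
    sums. *)
Lemma form_transfer : jump_bounded s r w -> jump_bounded r s w ->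
  exists2 C : R, 0 < C & forall A phi psi, uniq A ->
    sqint (dual s) phi -> sqint (dual r) psi ->
    \sum_(K <- A) `|jump (mass phi) K * jump (mass psi) K
       - jump (mass s) K * (mass phi K / mass s K) *
         (jump (mass r) K * (mass psi K / mass r K))| / mass w K
    <= C * (ip (dual s) phi phi + ip (dual r) psi psi).
Proof.
move=> h1 h2; have [C C0 A2] := joint_A2 h1.
move: h1 h2 => [C1 C10 h1] [C2 C20 h2].
exists (1 + (1 + C) + C1 + C2); first by rewrite !addr_gt0.
move=> A phi psi uA hphi hpsi.
have dphi := sqint_dintegrable ds s0 hphi.
have dpsi := sqint_dintegrable dr r0 hpsi.
have B1 := bessel_osc ms0 (mass_additive ds) (mass_additive dphi)
  (energy_bound_mass ds s0 hphi) uA.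
have B2 := bessel_osc mr0 (mass_additive dr) (mass_additive dpsi)
  (energy_bound_mass dr r0 hpsi) uA.
have {}h1 := h1 A phi uA hphi; have {}h2 := h2 A psi uA hpsi.
apply: (@le_trans _ _ (\sum_(K <- A) osc (mass s) (mass phi) K ^+ 2 / mass s K
  + (1 + C) * (\sum_(K <- A) osc (mass r) (mass psi) K ^+ 2 / mass r K)
  + \sum_(K <- A) jump_energy (mass w) (mass s) (mass psi) K
  + \sum_(K <- A) jump_energy (mass w) (mass r) (mass phi) K)); last first.
  have C1' : 0 <= 1 + C by rewrite addr_ge0 ?ltW.
  have := ler_wpM2l C1' B2; have n1 := ip_ge0 ts0 phi; have n2 := ip_ge0 tr0 psi.
  have := mulr_ge0 (ltW C0) n1; have := mulr_ge0 (ltW C10) n2.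
  have := mulr_ge0 (ltW C20) n1.
  move: B1 h1 h2 n1 n2; rewrite !mulrDl !mulrDr !mul1r -!/(dual _).
  by lra.
rewrite mulr_sumr -!big_split; apply: ler_sum => K _ /=.
have := @bilinear_error _ _ _ _ C (jump (mass phi) K) (jump (mass psi) K)
  (osc (mass s) (mass phi) K) (osc (mass r) (mass psi) K) (ms0 K) (mr0 K) (w0 K) (A2 K).
by rewrite /osc !subKr.
Qed.

End Equivalences.

Lemma sign_boundedP s r w : admissible s -> admissible r -> admissible w ->
  sign_bounded s r w <->
  [/\ jump_bounded s r w, jump_bounded r s w & pos_bounded s r w].
Proof.
move=> hs hr hw; split.
  move=> h; have habs := sign_bounded_abs hs hr hw h.
  have j1 := sign_bounded_jump hs hr hw h.
  have j2 : jump_bounded r s w.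
    apply: sign_bounded_jump => //; apply: abs_bounded_sign => //.
    exact: abs_bounded_sym.
  split => //; have [C C0 hC] := form_transfer hs hr hw j1 j2.
  move: habs => [D D0 hD]; exists (C + D); first by rewrite addr_gt0.
  move=> A phi psi uA hphi hpsi; rewrite mulrDl.
  apply: le_trans (lerD (hC _ _ _ uA hphi hpsi) (hD _ _ _ uA hphi hpsi)).
  rewrite -big_split; apply: ler_sum => K _ /=.
  rewrite /pos_term -mulrDl ler_pM2r ?invr_gt0 ?mass_gt0//; [|exact: hw.1|exact: hw.2].
  by rewrite -lerBlDr distrC; apply: lerB_dist.
move=> [j1 j2 [D D0 hD]]; apply: abs_bounded_sign => //.
have [C C0 hC] := form_transfer hs hr hw j1 j2.
exists (C + D); first by rewrite addr_gt0.
move=> A phi psi uA hphi hpsi; rewrite mulrDl.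
apply: le_trans (lerD (hC _ _ _ uA hphi hpsi) (hD _ _ _ uA hphi hpsi)).
rewrite -big_split; apply: ler_sum => K _ /=.
rewrite /pos_term -mulrDl ler_pM2r ?invr_gt0 ?mass_gt0//; [|exact: hw.1|exact: hw.2].
by rewrite -lerBlDr; apply: lerB_dist.
Qed.

End Forms.

(** * The square function *)

Section CountableSums.
Variable R : realType.
Local Notation mu := (@lebesgue_measure R).
Variable T : countType.
Implicit Types (a : T -> \bar R) (f : T -> R -> \bar R).

(** Enumerating the countable index type gives unordered sums the measurability and monotone
    convergence of series. *)
Lemma esum_nneseries a : (forall i, 0 <= a i)%E ->
  (\esum_(i in [set: T]) a i = \sum_(n <oo) oapp a 0%E (@pickle_inv T n))%E.
Proof.
move=> a0; pose b n := oapp a 0%E (@pickle_inv T n).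
have b0 n : (0 <= b n)%E by rewrite /b; case: pickle_inv => /=.
rewrite -/b nneseries_esumT//.
transitivity (\esum_(j in range (@choice.pickle T)) b j)%E.
  rewrite (@reindex_esum _ _ _ [set: T] (range (@choice.pickle T)) (@choice.pickle T))//.
    by apply: eq_esum => i _; rewrite /b pickleK_inv.
  split; [by move=> x|by move=> x y _ _ /(pcan_inj (@choice.pickleK T))|by []].
rewrite esum_mkcond; apply: eq_esum => n _.
case: ifPn => //; rewrite /b; case e : pickle_inv => [i|//] /=.
move=> /negP[]; apply/mem_set; exists i => //.
by have := @pickle_invK T n; rewrite e.
Qed.

Lemma le_sum_esum a (A : seq T) (S : set T) : (forall i, 0 <= a i)%E -> uniq A ->
  (forall i, i \in A -> S i) -> (\sum_(i <- A) a i <= \esum_(i in S) a i)%E.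
Proof.
move=> a0 uA AS; apply: esum_ge; exists [set` A].
  by split; [exact: finite_seq|move=> i /=; exact: AS].
by rewrite -fsbig_seq.
Qed.

Lemma esum_le a (c : \bar R) :
  (forall A : seq T, uniq A -> \sum_(i <- A) a i <= c)%E ->
  (\esum_(i in [set: T]) a i <= c)%E.
Proof.
move=> h; apply: ub_ereal_sup => _ [X [fX _] <-].
by rewrite fsbig_finite//=; apply: h; exact: finmap.fset_uniq.
Qed.

Lemma measurable_esum f : (forall i x, 0 <= f i x)%E ->
  (forall i, measurable_fun [set: R] (f i)) ->
  measurable_fun [set: R] (fun x => \esum_(i in [set: T]) f i x)%E.
Proof.
move=> f0 mf; rewrite (_ : (fun x => _) =
    (fun x => \sum_(n <oo) oapp (f^~ x) 0 (@pickle_inv T n))%E); last first.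
  by apply/funext => x; rewrite esum_nneseries.
apply: ge0_emeasurable_sum => [n x _ _|n _].
  by case: pickle_inv => /=.
by case: pickle_inv => [i|] /=; [exact: mf|exact: measurable_cst].
Qed.

Lemma integral_esum f : (forall i x, 0 <= f i x)%E ->
  (forall i, measurable_fun [set: R] (f i)) ->
  (\int[mu]_x (\esum_(i in [set: T]) f i x)
   = \esum_(i in [set: T]) \int[mu]_x f i x)%E.
Proof.
move=> f0 mf; rewrite esum_nneseries; last by move=> i; exact: integral_ge0.
under eq_integral do rewrite esum_nneseries//.
rewrite integral_nneseries//.
- apply: eq_eseriesr => n _; case: pickle_inv => //=.
  by rewrite integral0.
- by move=> n; case: pickle_inv => [i|] /=; [exact: mf|exact: measurable_cst].
- by move=> n x _; case: pickle_inv => /=.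
Qed.

Lemma esumZr a (c : R) : (forall i, 0 <= a i)%E -> 0 <= c ->
  ((\esum_(i in [set: T]) a i) * c%:E = \esum_(i in [set: T]) (a i * c%:E))%E.
Proof.
move=> a0 c0; rewrite !esum_nneseries//; last first.
  by move=> i; rewrite mule_ge0 ?lee_fin.
rewrite muleC -nneseriesZl//; last by move=> n _; case: pickle_inv => /=.
by apply: eq_eseriesr => n _; case: pickle_inv => [i|] /=; rewrite ?mule0// muleC.
Qed.

End CountableSums.

(** * The square function bound as a jump bound *)

Section SquareFunctionBounds.
Variable R : realType.
Local Notation mu := (@lebesgue_measure R).
Local Notation dint := (@dint R).
Local Notation dlen := (@dlen R).
Implicit Types (s r w phi f : R -> R) (I J K : dyadic) (A : seq dyadic).

Definition wdiff_bounded s r w := exists2 C : R, 0 < C &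
  forall A phi, uniq A -> sqint (dual s) phi ->
  \sum_(I <- A) wdiff_energy (mass w) (mass r) (mass phi) I
    <= C * ip (dual s) phi phi.

Lemma sqenergy_square_fun r w f : admissible r ->
  sqenergy r (square_fun w f) = (\esum_(I in [set: dyadic])
    (wdiff_energy (mass w) (mass r) (mass (fun x => f x * w x)%R) I)%:E)%E.
Proof.
move=> [dr r0]; rewrite /sqenergy.
pose c I := wdiff (mass w) (mass (fun x => f x * w x)) I ^+ 2.
have c0 I : 0 <= c I by exact: sqr_ge0.
pose F I x := (c I * (\1_(dint I) x * r x))%:E.
have F0 I x : (0 <= F I x)%E.
  by rewrite lee_fin mulr_ge0// mulr_ge0// ltW.
have e x : (`|square_fun w f x| ^+ 2 * (r x)%:E = \esum_(I in [set: dyadic]) F I x)%E.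
  have E I : `|wavg w f I - wavg w f (parent I)| ^+ 2 = c I.
    rewrite real_normK ?num_real//; congr (_ ^+ 2).
    by rewrite /wavg /wdiff /wmeas ![_^-1 * _]mulrC.
  rewrite /square_fun poweR12_sqrt; last first.
    by apply: esum_ge0 => I _; rewrite lee_fin mulr_ge0.
  rewrite gee0_abs ?sqrte_ge0// sqr_sqrte; last first.
    by apply: esum_ge0 => I _; rewrite lee_fin mulr_ge0.
  rewrite esumZr ?(ltW (r0 x))//.
  by apply: eq_esum => I _; rewrite E -EFinM -mulrA.
under eq_integral do rewrite e.
rewrite integral_esum//; last first.
  move=> I; apply/measurable_EFinP; apply: measurable_funM; first exact: measurable_cst.
  by apply: measurable_funM; [exact: (measurable_indic (measurable_dint I))|case: dr].
apply: eq_esum => I _; rewrite /wdiff_energy -/(c I).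
have i := integrable_indic_mul I dr.
have im : (\int[mu]_x (\1_(dint I) x * r x)%:E = (mass r I)%:E)%E.
  by rewrite -integral_indic_mul /Rintegral fineK//; exact: integrable_fin_num.
rewrite [RHS]EFinM -im -integralZl//.
Qed.

(** Multiplication by w is an isometry of L^2(a) onto L^2(1/s). Leaving a free covers both (i), with
    a = u w^2 and s = 1/u, and (ii), with a = 1/v and r = v w^2 in the role of s. *)
Lemma bounded_square_fun a s r w : admissible s -> admissible r -> admissible w ->
  measurable_fun [set: R] a -> (forall x, a x = w x ^+ 2 * dual s x) ->
  bounded_L2 a r (square_fun w) <-> wdiff_bounded s r w.
Proof.
move=> hs hr [dw w0] ma ea.
have mw : measurable_fun [set: R] w by case: dw.
have a0 x : 0 <= a x.
  by rewrite ea; apply: mulr_ge0 (sqr_ge0 _) _; exact: inv_ge0 hs.2 x.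
have r0 x : 0 <= r x by apply: ltW; exact: hr.2.
have tr f : measurable_fun [set: R] f -> sqint a f <->
    sqint (dual s) (fun x => f x * w x).
  have e x : f x ^+ 2 * a x = (f x * w x) ^+ 2 * dual s x by rewrite ea; ring.
  move=> mf; split=> -[_ h]; split=> //.
  - exact: measurable_funM.
  - by apply: eq_integrable h => // x _ /=; rewrite e.
  - by apply: eq_integrable h => // x _ /=; rewrite e.
have ipE f : ip a f f = ip (dual s) (fun x => f x * w x) (fun x => f x * w x).
  by apply: eq_Rintegral => x _; rewrite ea; ring.
have nn A phi : forall I, I \in A -> true -> (0 <= wdiff_energy (mass w) (mass r) (mass phi) I)%R.
  by move=> I _ _; apply: mulr_ge0 (sqr_ge0 _) (mass_ge0 _ _).
have nn' phi I : (0 <= (wdiff_energy (mass w) (mass r) (mass phi) I)%:E)%E.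
  by rewrite lee_fin; apply: mulr_ge0 (sqr_ge0 _) (mass_ge0 _ _).
rewrite bounded_L2P//; split=> -[C C0 h]; exists C => //.
  move=> A phi uA hphi.
  pose f x := phi x / w x.
  have fw : (fun x => f x * w x) = phi.
    by apply/funext => x; rewrite /f divfK// gt_eqF.
  have mf : measurable_fun [set: R] f.
    apply: measurable_funM; first by case: hphi.
    exact: (measurable_inv dw).
  have := h f; rewrite tr// fw => /(_ hphi); rewrite sqenergy_square_fun// ipE fw.
  rewrite -lee_fin -sumEFin; apply: le_trans.
  exact: le_sum_esum.
move=> f hf; have mf : measurable_fun [set: R] f by case: hf.
rewrite sqenergy_square_fun// ipE; apply: esum_le => A uA.
by rewrite sumEFin lee_fin; apply: h => //; apply/tr.
Qed.

Lemma sum_parents A : uniq A -> {subset A <= children (undup (map parent A))}.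
Proof.
by move=> uA I IA; apply: parent_children; rewrite mem_undup map_f.
Qed.

(** The bound on Q_J over finite trees. The root is excluded there, so the sum runs over the
    children of the nodes. *)
Definition carleson_bounded s r w := exists2 C : R, 0 < C & forall n J,
  \sum_(I <- children (tree n J)) carleson_term (mass w) (mass r) (mass s) I
    <= C * mass s J.

Lemma wdiff_jump_bounded s r w :
  admissible s -> admissible r -> admissible w ->
  (exists D : R, forall I, mass w (parent I) <= D * mass w I) ->
  carleson_bounded s r w ->
  wdiff_bounded s r w <-> jump_bounded s r w.
Proof.
move=> hs hr hw [D hD] [C C0 hC].
have w0 K := mass_gt0 K hw.1 hw.2; have wD := mass_additive hw.1.
have s0 K := mass_gt0 K hs.1 hs.2; have sD := mass_additive hs.1.
have r0 K := mass_gt0 K hr.1 hr.2; have rD := mass_additive hr.1.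
(* The 4 is the embedding constant, and the 2 is the price of [carleson_term_le]. *)
have pp A phi : uniq A -> sqint (dual s) phi ->
    \sum_(K <- A) paraproduct_energy (mass w) (mass r) (mass phi) K
      <= 4 * (2 * C) * ip (dual s) phi phi.
  move=> uA hphi; have dphi := sqint_dintegrable hs.1 hs.2 hphi.
  under eq_bigr do rewrite (paraproduct_energyE _ _ w0 s0).
  apply: carleson_embedding => //.
  - exact: mass_additive.
  - exact: energy_bound_mass hs.1 hs.2 _ hphi.
  - by rewrite mulr_gt0.
  - move=> K; apply: mulr_ge0 (ltW (r0 K)).
    by rewrite -exprMn sqr_ge0.
  - move=> n J; rewrite -mulrA.
    apply: (@le_trans _ _ (2 * \sum_(I <- children (tree n J))
        carleson_term (mass w) (mass r) (mass s) I)).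
      rewrite sum_children mulr_sumr; apply: ler_sum => K _.
      exact: carleson_term_le.
    by rewrite ler_pM2l.
have nn phi I : 0 <= wdiff_energy (mass w) (mass r) (mass phi) I.
  exact: mulr_ge0 (sqr_ge0 _) (ltW (r0 I)).
split=> -[C' C'0 h].
  exists (8 * C' + 2 * (4 * (2 * C))); first by rewrite addr_gt0 ?mulr_gt0.
  move=> A phi uA hphi; have dphi := sqint_dintegrable hs.1 hs.2 hphi.
  have hA := h _ phi (children_uniq uA) hphi; rewrite sum_children in hA.
  have hp := pp A phi uA hphi.
  apply: (@le_trans _ _ (8 * \sum_(K <- A) children_energy (mass w) (mass r) (mass phi) K
     + 2 * \sum_(K <- A) paraproduct_energy (mass w) (mass r) (mass phi) K)).
    rewrite !mulr_sumr -big_split; apply: ler_sum => K _ /=.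
    by apply: jump_energy_le => //; exact: mass_additive.
  rewrite [leRHS]mulrDl -[8 * _ * _]mulrA -[2 * _ * _]mulrA.
  by apply: lerD; rewrite ler_pM2l.
exists ((D ^+ 2 + 1) * (C' + 4 * (2 * C))).
  apply: mulr_gt0; last by rewrite addr_gt0 ?mulr_gt0.
  by rewrite ltr_wpDl ?sqr_ge0.
move=> A phi uA hphi; have dphi := sqint_dintegrable hs.1 hs.2 hphi.
(* Grouping by parents may add siblings absent from A, which is harmless because the terms are
   nonnegative. *)
set B := undup (map parent A).
have uB : uniq B by exact: undup_uniq.
apply: le_trans (sum_sub (nn phi) uA (sum_parents uA)) _.
rewrite -/B sum_children.
have hB := h B phi uB hphi; have hp := pp B phi uB hphi.
apply: (@le_trans _ _ (D ^+ 2 *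
  (\sum_(K <- B) jump_energy (mass w) (mass r) (mass phi) K
   + \sum_(K <- B) paraproduct_energy (mass w) (mass r) (mass phi) K))).
  rewrite -big_split mulr_sumr; apply: ler_sum => K _ /=.
  apply: children_energy_le => //; first exact: mass_additive.
    by have := hD (lhalf K); rewrite parent_lhalf.
  by have := hD (rhalf K); rewrite parent_rhalf.
apply: le_trans (ler_wpM2l (sqr_ge0 D) (lerD hB hp)) _.
rewrite -mulrDl -[leRHS]mulrA; apply: ler_wpM2r; last by rewrite lerDl.
apply: mulr_ge0; first by rewrite ltW// addr_gt0 ?mulr_gt0.
exact: ip_ge0 (inv_ge0 hs.2) _.
Qed.

End SquareFunctionBounds.

(** * The positive operator *)

Section PositiveOperator.
Variable R : realType.
Local Notation mu := (@lebesgue_measure R).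
Local Notation dint := (@dint R).
Local Notation dlen := (@dlen R).
Implicit Types (s r w v phi psi f : R -> R) (I J K : dyadic) (A : seq dyadic).

(** Fatou along an enumeration; the full sum may be infinite at some points, hence the
    extended-valued energy. *)
Lemma sqenergy_esum_le (T : countType) (t : R -> R) (b : T -> R -> R) (c : R) :
  measurable_fun [set: R] t -> (forall x, 0 <= t x) ->
  (forall i x, 0 <= b i x) -> (forall i, sqint t (b i)) ->
  (forall A : seq T, uniq A ->
    ip t (fun x => \sum_(i <- A) b i x) (fun x => \sum_(i <- A) b i x) <= c) ->
  (sqenergy t (fun x => \esum_(i in [set: T]) (b i x)%:E) <= c%:E)%E.
Proof.
move=> mt t0 b0 sb hc; rewrite /sqenergy.
pose A n : seq T := pmap (@pickle_inv T) (iota 0 n).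
have uA n : uniq (A n).
  apply: (@pmap_uniq _ _ _ (@choice.pickle T)); [exact: pickle_invK|exact: iota_uniq].
pose S n x : R := \sum_(i <- A n) b i x.
have sS n : sqint t (S n) by exact: sqint_sum.
have S0 n x : 0 <= S n x by exact: sumr_ge0.
pose h n x := ((S n x ^+ 2 * t x)%:E).
have mh n : measurable_fun [set: R] (h n).
  apply/measurable_EFinP; apply: measurable_funM => //.
  by apply: measurable_funX; case: (sS n).
have h0 n x : (0 <= h n x)%E.
  by rewrite lee_fin; apply: mulr_ge0 (sqr_ge0 _) _.
have E0 x : (0 <= \esum_(i in [set: T]) (b i x)%:E)%E.
  by apply: esum_ge0 => i _; rewrite lee_fin.
have Sl x : (S n x)%:E @[n --> \oo] --> (\esum_(i in [set: T]) (b i x)%:E)%E.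
  rewrite esum_nneseries; last by move=> i; rewrite lee_fin.
  rewrite (_ : (fun n => (S n x)%:E) = (fun n =>
      \sum_(0 <= k < n) oapp (fun i => (b i x)%:E) 0 (@pickle_inv T k))%E).
    by apply: is_cvg_nneseries => n _ _; case: pickle_inv => [i|] //=; rewrite lee_fin.
  apply/funext => n; rewrite /S /A -sumEFin /index_iota subn0.
  elim: (iota 0 n) => [|k l IHl]; first by rewrite !big_nil.
  by rewrite big_cons -IHl /=; case: pickle_inv => [i|] /=; rewrite ?big_cons ?add0e.
have -> : (\int[mu]_x (`|\esum_(i in [set: T]) (b i x)%:E| ^+ 2 * (t x)%:E)
    = \int[mu]_x limn_einf (h ^~ x))%E.
  apply: eq_integral => x _; apply/esym; apply: (cvg_limn_einf_sup _).1.
  rewrite gee0_abs// expe2.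
  rewrite (_ : h^~ x = fun n => ((S n x)%:E * (S n x)%:E * (t x)%:E)%E); last first.
    by apply/funext => n; rewrite /h expr2 !EFinM.
  apply: cvgeZr => //; apply: cvgeM; [|exact: Sl|exact: Sl].
  move: (E0 x); case: (\esum_(i in _) _) => [e|_|//]; first by [].
  by rewrite mule_defE.
apply: le_trans (fatou mu measurableT mh (fun n x _ => h0 n x)) _.
rewrite limn_einf_lim; apply: lime_le; first exact: is_cvg_einfs.
apply: nearW => n; apply: (@le_trans _ _ (\int[mu]_x h n x)%E).
  by apply: ereal_inf_lbound; exists n => /=.
rewrite -[X in (X <= _)%E]sqenergyE// sqenergy_ip// lee_fin; exact: hc.
Qed.

Lemma le_sqenergy (t : R -> R) (F G : R -> \bar R) :
  measurable_fun [set: R] t -> (forall x, 0 <= t x) ->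
  measurable_fun [set: R] F -> measurable_fun [set: R] G ->
  (forall x, `|F x| <= `|G x|)%E -> (sqenergy t F <= sqenergy t G)%E.
Proof.
move=> mt t0 mF mG FG.
have mS (H : R -> \bar R) : measurable_fun [set: R] H ->
    measurable_fun [set: R] (fun x => `|H x| ^+ 2 * (t x)%:E)%E.
  move=> mH; apply: emeasurable_funM; last exact/measurable_EFinP.
  under eq_fun do rewrite expe2.
  by apply: emeasurable_funM; exact: measurableT_comp.
apply: ge0_le_integral => //.
- by move=> x _; rewrite mule_ge0 ?lee_fin// expe_ge0.
- exact: mS.
- exact: mS.
- move=> x _; apply: lee_wpmul2r; first by rewrite lee_fin.
  by rewrite !expe2 lee_pmul.
Qed.

Lemma measurable_pos_op w lam f : measurable_fun [set: R] w ->
  measurable_fun [set: R] (pos_op w lam f).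
Proof.
move=> mw; have ma I : measurable_fun [set: R]
    (fun x => (w x / dlen I * lam I * avg f I * \1_(dint I) x)%:E).
  apply/measurable_EFinP; apply: measurable_funM; last exact: (measurable_indic (measurable_dint I)).
  do 3 (apply: measurable_funM; last exact: measurable_cst); exact: mw.
apply: emeasurable_funB; apply: measurable_esum => [I x|I].
- exact: funepos_ge0.
- rewrite [X in measurable_fun _ X](_ : _ = (fun x => maxe
    (w x / dlen I * lam I * avg f I * \1_(dint I) x)%:E 0%E)).
    by apply: measurable_maxe => //; exact: measurable_cst.
  by apply/funext => x; rewrite unlock.
- exact: funeneg_ge0.
- rewrite [X in measurable_fun _ X](_ : _ = (fun x => maxe (oppe
    (w x / dlen I * lam I * avg f I * \1_(dint I) x)%:E) 0%E)).
    by apply: measurable_maxe => //; exact: measurableT_comp.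
  by apply/funext => x; rewrite unlock.
Qed.

Section Boundedness.
Variables (s r w v : R -> R) (lam : dyadic -> R).
Hypotheses (hs : admissible s) (hr : admissible r) (hw : admissible w).
Hypotheses (mv : measurable_fun [set: R] v) (v0 : forall x, 0 < v x).
Hypothesis rE : forall x, r x = v x * w x ^+ 2.
(** The 4 is 2 * 2: each difference of averages is a jump divided by |I| / 2. *)
Hypothesis lamE : forall I, lam I = 4 * `|jump (mass s) I * jump (mass r) I|
  * dlen I ^+ 2 / (mass s I * mass r I * mass w I).
Let ds : dintegrable s := hs.1.
Let s0 : forall x, 0 < s x := hs.2.
Let dr : dintegrable r := hr.1.
Let r0 : forall x, 0 < r x := hr.2.
Let mtr : measurable_fun [set: R] (dual r) := measurable_inv dr.
Let tr0 x : 0 <= dual r x := inv_ge0 r0 x.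
Let mts : measurable_fun [set: R] (dual s) := measurable_inv ds.
Let ts0 x : 0 <= dual s x := inv_ge0 s0 x.
Let w0 K : 0 < mass w K := mass_gt0 K hw.1 hw.2.
Let ms0 K : 0 < mass s K := mass_gt0 K ds s0.
Let mr0 K : 0 < mass r K := mass_gt0 K dr r0.
Let v0' x : 0 <= v x := ltW (v0 x).
Let mw : measurable_fun [set: R] w := hw.1.1.

Let term phi I x : R := w x / dlen I * lam I * avg phi I * \1_(dint I) x.

Let coef phi I : R := lam I / dlen I * avg phi I.

(** The function [term] multiplied by r / w, the same isometry of L^2(v) onto L^2(1/r) as for the
    Haar terms. *)
Let step phi I x : R := coef phi I * (\1_(dint I) x * r x).

Let lam_ge0 I : 0 <= lam I.
Proof.
rewrite lamE divr_ge0//; last by rewrite ltW// !mulr_gt0.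
by apply: mulr_ge0 (sqr_ge0 _); rewrite mulr_ge0.
Qed.

Let sqint_step phi I : sqint (dual r) (step phi I).
Proof. by apply: sqintZ; exact: sqint_indic. Qed.

Let termE phi I x : term phi I x * r x = w x * step phi I x.
Proof. by rewrite /term /step /coef; ring. Qed.

Let ip_term A phi :
  ip v (fun x => \sum_(I <- A) term phi I x) (fun x => \sum_(I <- A) term phi I x)
  = ip (dual r) (fun x => \sum_(I <- A) step phi I x)
                (fun x => \sum_(I <- A) step phi I x).
Proof.
apply: eq_Rintegral => x _.
have -> : \sum_(I <- A) term phi I x = w x / r x * \sum_(I <- A) step phi I x.
  rewrite mulr_sumr; apply: eq_bigr => I _.
  by rewrite mulrAC -termE mulfK// gt_eqF.
have wx := hw.2 x; rewrite /dual rE; have vx := v0 x.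
by field; rewrite !gt_eqF.
Qed.

Let sqint_term phi I : sqint v (term phi I).
Proof.
have [m1 h] := sqint_step phi I; split.
  apply: measurable_funM; last exact: (measurable_indic (measurable_dint I)).
  by do 3 (apply: measurable_funM; last exact: measurable_cst).
apply: eq_integrable h => // x _ /=; congr EFin.
have wx := hw.2 x; have vx := v0 x.
have l0 := @dlen_gt0 R I.
by rewrite /step /dual /coef /term rE; field; rewrite !gt_eqF.
Qed.

Let ip_step A phi psi : sqint (dual r) psi ->
  ip (dual r) (fun x => \sum_(I <- A) step phi I x) psi
  = \sum_(I <- A) coef phi I * mass psi I.
Proof.
move=> hpsi; rewrite ip_suml//; apply: eq_bigr => I _.
by rewrite (ipZl mtr tr0)//; [rewrite ipC ip_indic|exact: sqint_indic].
Qed.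

Let coef_pos_term phi psi I : (forall x, 0 <= phi x) -> (forall x, 0 <= psi x) ->
  coef phi I * mass psi I = 4 * pos_term s r w phi psi I.
Proof.
move=> p0 q0; have l0 := @dlen_gt0 R I.
have -> : pos_term s r w phi psi I = `|jump (mass s) I * jump (mass r) I| *
    (mass phi I * mass psi I / (mass s I * mass r I * mass w I)).
  rewrite /pos_term mulrACA normrM.
  rewrite (ger0_norm (_ : 0 <= mass phi I / _ * _)); last first.
    by apply: mulr_ge0; apply: divr_ge0; rewrite ?(ltW (ms0 _)) ?(ltW (mr0 _)) ?mass_ge0.
  by field; rewrite !gt_eqF.
by rewrite /coef lamE avgE; field; rewrite !gt_eqF.
Qed.

(** Positivity of the operator: it suffices to treat nonnegative functions, for which
    [coef_pos_term] is an identity. *)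
Let pos_term_abs phi psi I : dintegrable phi -> dintegrable psi ->
  pos_term s r w phi psi I <=
  pos_term s r w (fun x => `|phi x|) (fun x => `|psi x|) I.
Proof.
move=> dphi dpsi; rewrite /pos_term ler_pM2r ?invr_gt0// !normrM.
have h g : dintegrable g -> `|mass g I| <= `|mass (fun x => `|g x|) I|.
  move=> dg; rewrite [leRHS]ger0_norm ?mass_ge0//.
  exact: le_normr_Rintegral (measurable_dint I) (dg.2 I).
by apply: ler_pM => //; do ?[exact: mulr_ge0]; rewrite ?ler_wpM2l// ler_wpM2r// h.
Qed.

Let sqint_abs (t : R -> R) phi : measurable_fun [set: R] t -> (forall x, 0 <= t x) ->
  sqint t phi -> sqint t (fun x => `|phi x|) /\
  ip t (fun x => `|phi x|) (fun x => `|phi x|) = ip t phi phi.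
Proof.
move=> mt t0 [mphi hphi]; split.
  split; first exact: measurableT_comp.
  apply: eq_integrable hphi => // x _ /=.
  by rewrite real_normK ?num_real.
by apply: eq_Rintegral => x _; rewrite -normrM ger0_norm// -expr2 sqr_ge0.
Qed.

Lemma bounded_pos_op :
  bounded_L2 (dual s) v (pos_op w lam) <-> pos_bounded s r w.
Proof.
rewrite bounded_L2P//; split=> -[C C0 h].
  exists (C + 1); first by rewrite addr_gt0.
  move=> A phi psi uA hphi hpsi.
  have dphi := sqint_dintegrable ds s0 hphi.
  have dpsi := sqint_dintegrable dr r0 hpsi.
  have [ha ea] := sqint_abs mts ts0 hphi; have [hb eb] := sqint_abs mtr tr0 hpsi.
  set a := (fun x => `|phi x|) in ha ea; set b := (fun x => `|psi x|) in hb eb.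
  have a0 x : 0 <= a x by exact: normr_ge0.
  have b0 x : 0 <= b x by exact: normr_ge0.
  have hS : sqint (dual r) (fun x => \sum_(I <- A) step a I x) by exact: sqint_sum.
  have t0 I x : 0 <= term a I x.
    rewrite /term; apply: mulr_ge0 => //; apply: mulr_ge0; last first.
      by rewrite avgE divr_ge0 ?mass_ge0// ltW// dlen_gt0.
    by apply: mulr_ge0 => //; rewrite divr_ge0// ltW ?dlen_gt0//; exact: hw.2.
  have hT : sqint v (fun x => \sum_(I <- A) term a I x) by exact: sqint_sum.
  have FF : ip (dual r) (fun x => \sum_(I <- A) step a I x)
       (fun x => \sum_(I <- A) step a I x) <= C * ip (dual s) phi phi.
    rewrite -ip_term -ea -lee_fin -sqenergy_ip//; apply: le_trans (h a ha).
    apply: le_sqenergy => //.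
    - by apply/measurable_EFinP; case: hT.
    - exact: measurable_pos_op.
    - move=> x.
      rewrite gee0_abs ?lee_fin ?sumr_ge0//; apply: le_trans (lee_abs _).
      rewrite /pos_op /= -sumEFin.
      have -> : (\esum_(I in [set: dyadic])
          ((fun I => (w x / dlen I * lam I * avg a I * \1_(dint I) x)%:E)^\- I) = 0)%E.
        apply: esum1 => I _; rewrite funenegE max_r// oppe_le0 lee_fin.
        exact: t0.
      rewrite sube0; apply: (@le_trans _ _ (\esum_(I in [set: dyadic]) (term a I x)%:E)%E).
        by apply: le_sum_esum => // I; rewrite lee_fin.
      by apply: le_esum => I _; rewrite funeposE le_max lexx.
  apply: (@le_trans _ _ (\sum_(I <- A) pos_term s r w a b I)).
    by apply: ler_sum => I _; exact: pos_term_abs.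
  have := ip_le_half mtr tr0 hS hb; rewrite ip_step//.
  rewrite (eq_bigr (fun I => 4 * pos_term s r w a b I)); last first.
    by move=> I _; rewrite coef_pos_term.
  rewrite -mulr_sumr eb; have := ip_ge0 ts0 phi; have := ip_ge0 tr0 psi.
  have := mulr_ge0 (ltW C0) (ip_ge0 tr0 psi); have := mulr_ge0 (ltW C0) (ip_ge0 ts0 phi).
  move: FF; rewrite mulrDl mulrDr mul1r; lra.
exists (4 * (4 * C) ^+ 2); first by rewrite mulr_gt0 ?exprn_gt0 ?mulr_gt0.
move=> f hf; have df := sqint_dintegrable ds s0 hf.
have [ha ea] := sqint_abs mts ts0 hf; set a := (fun x => `|f x|) in ha ea.
have a0 x : 0 <= a x by exact: normr_ge0.
have avg0 I : 0 <= avg a I by rewrite avgE divr_ge0 ?mass_ge0// ltW// dlen_gt0.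
have t0 I x : 0 <= term a I x.
  rewrite /term; apply: mulr_ge0 => //; apply: mulr_ge0 => //.
  by apply: mulr_ge0 => //; rewrite divr_ge0// ltW ?dlen_gt0//; exact: hw.2.
have mT I : measurable_fun [set: R] (EFin \o term a I).
  by apply/measurable_EFinP; case: (sqint_term a I).
have mE : measurable_fun [set: R] (fun x => \esum_(I in [set: dyadic]) (term a I x)%:E)%E.
  by apply: measurable_esum => // I x; rewrite lee_fin.
(* Positive and negative parts are added rather than subtracted, so the bound also holds where both
   sums are infinite. *)
apply: (@le_trans _ _ (sqenergy v (fun x => \esum_(I in [set: dyadic]) (term a I x)%:E)%E)).
  apply: le_sqenergy => //; first exact: measurable_pos_op.
  move=> x.
    rewrite [leRHS]gee0_abs; last by apply: esum_ge0 => I _; rewrite lee_fin.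
    rewrite /pos_op; set c := (fun I => _%:E).
    apply: le_trans (lee_abs_sub _ _) _.
    rewrite !gee0_abs; [|by apply: esum_ge0 => I _; exact: funeneg_ge0|by apply: esum_ge0 => I _; exact: funepos_ge0].
    rewrite -esumD; [|by move=> I _; exact: funepos_ge0|by move=> I _; exact: funeneg_ge0].
    apply: le_esum => I _; have := congr1 (@^~ I) (fune_abse c) => /= <-.
    rewrite /c lee_fin /term normrM (ger0_norm (_ : 0 <= \1_(dint I) x))//.
    rewrite ler_wpM2r// normrM ger0_norm; last first.
      by apply: mulr_ge0 => //; rewrite divr_ge0// ltW ?dlen_gt0//; exact: hw.2.
    rewrite ler_wpM2l//.
      by apply: mulr_ge0 => //; rewrite divr_ge0// ltW ?dlen_gt0//; exact: hw.2.
    have d0 : 0 <= (dlen I)^-1 by rewrite invr_ge0 ltW ?dlen_gt0.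
    rewrite !avgE normrM (ger0_norm d0); apply: ler_wpM2r => //.
    exact: le_normr_Rintegral (measurable_dint I) (df.2 I).
apply: sqenergy_esum_le => // A uA; rewrite ip_term -ea.
apply: ip_le_of_test => //; first by rewrite mulr_gt0.
  exact: sqint_sum.
move=> psi hpsi; have dpsi := sqint_dintegrable dr r0 hpsi.
have [hb eb] := sqint_abs mtr tr0 hpsi; set b := (fun x => `|psi x|) in hb eb.
have b0 x : 0 <= b x by exact: normr_ge0.
rewrite ip_step// -eb -mulrA; apply: (@le_trans _ _ (4 * \sum_(I <- A) pos_term s r w a b I)); last first.
  by rewrite ler_pM2l//; exact: (h A a b uA ha hb).
rewrite mulr_sumr; apply: ler_sum => I _; rewrite -coef_pos_term//.
apply: ler_wpM2l; first by rewrite mulr_ge0// divr_ge0// ltW// dlen_gt0.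
apply: le_trans (ler_norm _) _.
exact: le_normr_Rintegral (measurable_dint I) (dpsi.2 I).
Qed.

End Boundedness.

End PositiveOperator.

(** * Haar multipliers *)

Section HaarMultiplier.
Variable R : realType.
Local Notation mu := (@lebesgue_measure R).
Local Notation dint := (@dint R).
Local Notation dlen := (@dlen R).
Implicit Types (s r w v phi psi f g : R -> R) (I J K : dyadic) (A : seq dyadic).

Lemma cvg_totally0 (T : choiceType) (h : {fset T} -> \bar R) :
  (forall B, 0 <= h B)%E ->
  (h @ totally --> 0%E) <-> (forall eta : R, 0 < eta ->
    exists B0 : {fset T}, forall B, (B0 `<=` B)%fset -> (h B <= eta%:E)%E).
Proof.
move=> h0; have PT := @totally_filter T; split=> [|hc].
  move=> /fine_cvgP[[F0 _ hF0] /cvgrPdist_le hc] eta eta0.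
  have [B0 _ hB0] := hc eta eta0.
  exists (F0 `|` B0)%fset => B; rewrite fsubUset => /andP[FB BB].
  have := hB0 B BB; rewrite /= sub0r normrN ger0_norm ?fine_ge0// -lee_fin.
  by rewrite fineK//; exact: hF0 B FB.
apply/fine_cvgP; split.
  have [B0 hB0] := hc 1 ltr01; exists B0 => // B /hB0 hB.
  by rewrite ge0_fin_numE//; exact: le_lt_trans hB (ltry _).
apply/cvgrPdist_le => eta /hc[B0 hB0]; exists B0 => // B /hB0 hB /=.
rewrite sub0r normrN ger0_norm ?fine_ge0// -lee_fin fineK//.
by rewrite ge0_fin_numE//; exact: le_lt_trans hB (ltry _).
Qed.

Section Multiplier.
Variables (s r w v : R -> R).
Hypotheses (hs : admissible s) (hr : admissible r) (hw : admissible w).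
Hypotheses (mv : measurable_fun [set: R] v) (v0 : forall x, 0 < v x).
Hypothesis rE : forall x, r x = v x * w x ^+ 2.
Let v0' x : 0 <= v x := ltW (v0 x).
Let mts : measurable_fun [set: R] (dual s) := measurable_inv hs.1.
Let ts0 x : 0 <= dual s x := inv_ge0 hs.2 x.

Let term f I x : R := w x / avg w I * pairing f (haar I) * haar I x.

Let termE f I x : term f I x = w x / r x * haar_term r w f I x.
Proof.
have := hr.2 x; rewrite /term /haar_term => rx.
by move: (avg w I)^-1 (pairing _ _) (haar I x) => a p h; field; rewrite gt_eqF.
Qed.

Let sqrE x a : v x * (w x / r x * a) ^+ 2 = a ^+ 2 * dual r x.
Proof.
have wx := hw.2 x; have vx := v0 x; rewrite /dual rE.
by field; rewrite !gt_eqF.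
Qed.

Let sqint_term f I : sqint v (term f I).
Proof.
have [m1 h] := sqint_haar_term w hr f I; split.
  have -> : term f I = fun x => w x * ((r x)^-1 * haar_term r w f I x).
    by apply/funext => x; rewrite termE -mulrA.
  apply: measurable_funM; first by case: hw => -[].
  by apply: measurable_funM => //; exact: (measurable_inv hr.1).
apply: eq_integrable h => // x _ /=; congr EFin.
by rewrite termE [RHS]mulrC sqrE.
Qed.

Let partialE f eps A x :
  partial (term f) eps A x = w x / r x * partial (haar_term r w f) eps A x.
Proof.
by rewrite /partial mulr_sumr; apply: eq_bigr => I _; rewrite termE mulrCA.
Qed.

Let ip_partialE f eps A : ip v (partial (term f) eps A) (partial (term f) eps A)
  = ip (dual r) (partial (haar_term r w f) eps A) (partial (haar_term r w f) eps A).
Proof.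
by apply: eq_Rintegral => x _; rewrite partialE -!expr2 mulrC sqrE.
Qed.

Let haar_sumE f eps A x :
  \sum_(I <- A) haar_mult_term w eps f I x = partial (term f) eps A x.
Proof.
by apply: eq_bigr => I _; rewrite /haar_mult_term /term !mulrA.
Qed.

Lemma haar_mult_unif_boundedP :
  haar_mult_unif_bounded (dual s) v w <-> sign_bounded s r w.
Proof.
have L0 (F : R -> \bar R) : (0 <= L2norm v F)%E by exact: poweR_ge0.
have Lle (F : R -> R) k : 0 <= k -> sqint v F ->
    (L2norm v (EFin \o F) <= k%:E)%E = (ip v F F <= k ^+ 2).
  move=> k0 hF; rewrite L2normE// sqenergy_ip//.
  have {1}-> : k%:E = sqrte (k ^+ 2)%:E by rewrite /= sqrtr_sqr ger0_norm.
  by rewrite lee_sqrt ?lee_fin ?sqr_ge0.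
split=> -[C C0 h]; last first.
  exists (Num.sqrt C); first by rewrite sqrtr_gt0.
  move=> eps heps f /(inL2P mts ts0) hf.
  have hM A d : uniq A -> signed d ->
      ip v (partial (term f) d A) (partial (term f) d A) <= C * ip (dual s) f f.
    by move=> uA sd; rewrite ip_partialE; exact: h.
  have [g [hg gM] hlim] := unconditional_sum mv v0 (sqint_term f) hM heps.
  exists g; last first.
    rewrite L2norm_le ?sqrtr_ge0// !sqenergy_ip// sqr_sqrtr ?(ltW C0)//.
  split; first by case: hg.
  apply/cvg_totally0 => // eta eta0.
  have [A uA hA] := hlim (eta ^+ 2) (exprn_gt0 2 eta0).
  exists (seq_fset tt A) => B /fsubsetP AB.
  have [|hB1 hB2] := hA (enum_fset B) (fset_uniq B).
    by move=> I IA; apply: AB; rewrite seq_fsetE.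
  have -> : (fun x => (g x - \sum_(I <- B) haar_mult_term w eps f I x)%:E) =
      EFin \o (fun x => g x - partial (term f) eps (enum_fset B) x).
    by apply/funext => x /=; rewrite haar_sumE.
  by rewrite Lle// ltW.
(* Up to a small error, 4 |F|^2 = |g + g'|^2 is bounded, through two uses of |a + b|^2 <= 2 |a|^2 +
   2 |b|^2, by 8 C^2 times the squared norm of f. *)
exists (2 * C ^+ 2); first by rewrite mulr_gt0 ?exprn_gt0.
move=> A eps f uA heps hf; rewrite -ip_partialE.
(* Adding the sums for [eps] and [eps'] cancels everything off A and doubles the part on A. *)
pose eps' I := if I \in A then eps I else - eps I.
have heps' : signed eps'.
  move=> I; rewrite /eps'; case: ifP => // _.
  by case: (heps I) => ->; rewrite ?opprK; [right|left].
have hf' := (inL2P mts ts0 f).2 hf.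
have [g [mg lg] ng] := h eps heps f hf'.
have [g' [mg' lg'] ng'] := h eps' heps' f hf'.
have sg k : measurable_fun [set: R] k ->
    (L2norm v (EFin \o k) <= C%:E * L2norm (dual s) (EFin \o f))%E ->
    sqint v k /\ ip v k k <= C ^+ 2 * ip (dual s) f f.
  move=> mk; rewrite L2norm_le ?(ltW C0)// [X in (_ * X)%E]sqenergy_ip//.
  move=> le; have sk : sqint v k.
    by apply/sqintP => //; apply: le_lt_trans le _; rewrite -EFinM ltry.
  by split => //; move: le; rewrite sqenergy_ip// -EFinM lee_fin.
have [hg Ng] := sg g mg ng; have [hg' Ng'] := sg g' mg' ng'.
apply/ler_addgt0Pr => eta eta0.
have q0 : 0 < Num.sqrt (eta / 2) by rewrite sqrtr_gt0 divr_gt0.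
have [B1 hB1] := (cvg_totally0 (fun B => L0 _)).1 lg _ q0.
have [B2 hB2] := (cvg_totally0 (fun B => L0 _)).1 lg' _ q0.
pose B := (seq_fset tt A `|` (B1 `|` B2))%fset.
have AB : {subset A <= enum_fset B}.
  by move=> I IA; rewrite in_fsetU seq_fsetE IA.
have {}hB1 : (L2norm v (EFin \o (fun x => g x - partial (term f) eps (enum_fset B) x)%R)
    <= (Num.sqrt (eta / 2))%:E)%E.
  have := hB1 B; rewrite (_ : (fun x => _) =
    EFin \o (fun x => g x - partial (term f) eps (enum_fset B) x)).
    by apply; rewrite /B fsetUA [(_ `|` B1)%fset]fsetUC -fsetUA fsubsetUl.
  by apply/funext => x /=; rewrite haar_sumE.
have {}hB2 : (L2norm v (EFin \o (fun x => g' x - partial (term f) eps' (enum_fset B) x)%R)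
    <= (Num.sqrt (eta / 2))%:E)%E.
  have := hB2 B; rewrite (_ : (fun x => _) =
    EFin \o (fun x => g' x - partial (term f) eps' (enum_fset B) x)).
    by apply; rewrite /B fsetUA fsubsetUr.
  by apply/funext => x /=; rewrite haar_sumE.
have sD k d : sqint v k -> sqint v (fun x => k x - partial (term f) d (enum_fset B) x).
  move=> hk; have := sqintD mv v0' hk (sqintZ (-1) (sqint_partial mv v0 (sqint_term f) d (enum_fset B))).
  by congr (sqint v _); apply/funext => x; rewrite mulN1r.
rewrite Lle ?sqrtr_ge0 ?sqr_sqrtr ?divr_ge0 ?(ltW eta0)// in hB1; last exact: sD.
rewrite Lle ?sqrtr_ge0 ?sqr_sqrtr ?divr_ge0 ?(ltW eta0)// in hB2; last exact: sD.
set D1 := (fun x => g x - _) in hB1; set D2 := (fun x => g' x - _) in hB2.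
have sD1 : sqint v D1 by exact: sD.
have sD2 : sqint v D2 by exact: sD.
have sgg := sqintD mv v0' hg hg'; have sDD := sqintD mv v0' sD1 sD2.
set F := partial (term f) eps A.
have sF : sqint v F by exact: sqint_partial.
have e2F : (fun x => 2 * F x) = (fun x => (g x + g' x) - (D1 x + D2 x)).
  apply/funext => x; rewrite /D1 /D2.
  suff : partial (term f) eps (enum_fset B) x + partial (term f) eps' (enum_fset B) x = 2 * F x.
    by move=> <-; ring.
  rewrite /partial -big_split /= (bigID (mem A)) /= [X in _ + X]big1 ?addr0; last first.
    by move=> I /negbTE nA; rewrite /eps' nA mulNr subrr.
  rewrite -big_filter (perm_big A); last first.
    apply: uniq_perm => //; first by rewrite filter_uniq// fset_uniq.
    by move=> I; rewrite mem_filter; case IA : (I \in A) => //=; rewrite AB.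
  rewrite /F /partial mulr_sumr; apply: eq_big_seq => I IA.
  by rewrite /eps' IA; ring.
have e4 : ip v (fun x => 2 * F x) (fun x => 2 * F x) = 4 * ip v F F.
  have s2F := sqintZ 2 sF.
  by rewrite (ipZl mv v0')// ipC (ipZl mv v0')//; ring.
have := ip_sub_le mv v0' sgg sDD; rewrite -e2F e4.
have := ip_add_le mv v0' hg hg'; have := ip_add_le mv v0' sD1 sD2.
by move: Ng Ng' hB1 hB2; rewrite -mulrA; lra.
Qed.

End Multiplier.

End HaarMultiplier.

(** * Everywhere positive weights *)

Section PositiveWeights.
Variable R : realType.
Local Notation mu := (@lebesgue_measure R).
Local Notation dint := (@dint R).
Local Notation dlen := (@dlen R).
Implicit Types (s r u v w : R -> R) (I J K : dyadic) (A : seq dyadic).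

Lemma carleson_bounded_of_esum s r w (C : R) :
  admissible s -> admissible r -> admissible w -> 0 < C ->
  (forall J, ((dlen J)^-1%:E * (\esum_(I in dsub R J `\ J)
     (dlen (parent I) * `|avg s I / avg w I| ^+ 2
      * `|1 - avg w I / avg w (parent I)| ^+ 2 * avg r (parent I))%:E)
     <= (C * avg s J)%:E)%E) ->
  carleson_bounded s r w.
Proof.
move=> hs hr hw C0 h; exists C => // n J.
have w0 K := mass_gt0 K hw.1 hw.2.
have e I : dlen (parent I) * `|avg s I / avg w I| ^+ 2
      * `|1 - avg w I / avg w (parent I)| ^+ 2 * avg r (parent I)
    = carleson_term (mass w) (mass r) (mass s) I.
  have l0 := @dlen_gt0 R I; have w1 := w0 I; have w2 := w0 (parent I).
  have lp : dlen (parent I) = 2 * dlen I.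
    by rewrite (@dlen_half _ (parent I) I)//; case: (I) => j k /=; lia.
  rewrite !real_normK ?num_real// /carleson_term !avgE lp.
  by field; rewrite !gt_eqF.
have c0 I : 0 <= carleson_term (mass w) (mass r) (mass s) I.
  apply: mulr_ge0; first by rewrite -exprMn sqr_ge0.
  by apply: mass_ge0 => x; apply: ltW; exact: hr.2.
have l0 := @dlen_gt0 R J.
have : ((dlen J)^-1%:E * (\sum_(I <- children (tree n J))
    (carleson_term (mass w) (mass r) (mass s) I)%:E) <= (C * avg s J)%:E)%E.
  apply: le_trans (h J); apply: lee_wpmul2l; first by rewrite lee_fin invr_ge0 ltW.
  under [leRHS]eq_esum do rewrite e.
  apply: le_sum_esum => [I||I]; first by rewrite lee_fin.
    exact: children_uniq (tree_uniq n J).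
  move=> Ic; split.
    apply: subset_trans (@tree_dint R n J _ (children_sub Ic)).
    by case: (dyadic_half I) => {1}->; [exact: dint_lhalf_sub|exact: dint_rhalf_sub].
  move=> /= eI; have /tree_ancestor[m _] := children_sub Ic.
  by move=> /(congr1 fst); rewrite eI iter_parent_level /=; lia.
by rewrite sumEFin -EFinM lee_fin avgE mulrA mulrC ler_pM2r ?invr_gt0.
Qed.

Lemma doubling_constant w : admissible w -> dyadic_doubling w ->
  exists D : R, forall I, mass w (parent I) <= D * mass w I.
Proof.
move=> hw; rewrite /dyadic_doubling; set S := ereal_sup _ => Sy.
have w0 K := mass_gt0 K hw.1 hw.2.
have hS I : ((mass w (parent I) / mass w I)%:E <= S)%E.
  by apply: ereal_sup_ubound; exists I.
have Sfin : S \is a fin_num.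
  rewrite fin_numE -ltey -ltNye Sy andbT.
  exact: lt_le_trans (ltNyr _) (hS (0, 0)).
exists (fine S) => I; rewrite -ler_pdivrMr// -lee_fin fineK//.
Qed.

(** Exchanging s and r turns Q_J into R_J and condition (i) into (ii), since 1/v = w^2 / r; the jump
    bound is thus obtained twice from the same lemmas. *)
Lemma haar_multiplier_positive u v w (C1 C2 : R) :
  measurable_fun [set: R] u -> measurable_fun [set: R] v ->
  (forall x, 0 < u x) -> (forall x, 0 < v x) -> (forall x, 0 < w x) ->
  locally_integrable [set: R] w ->
  locally_integrable [set: R] (fun x => (u x)^-1) ->
  locally_integrable [set: R] (fun x => v x * w x ^+ 2) ->
  dyadic_doubling w -> 0 < C1 -> 0 < C2 ->
  (forall J, (Qsum u v w J <= (C1 * avg (fun x => (u x)^-1)%R J)%:E)%E) ->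
  (forall J, (Rsum u v w J <= (C2 * avg (fun x => (v x * w x ^+ 2)%R) J)%:E)%E) ->
  haar_mult_unif_bounded u v w <->
  [/\ bounded_L2 (fun x => u x * w x ^+ 2) (fun x => v x * w x ^+ 2) (square_fun w),
      bounded_L2 (fun x => (v x)^-1) (fun x => (u x)^-1) (square_fun w)
    & bounded_L2 u v (pos_op w (lambda_coef u v w))].
Proof.
move=> mu_ mv u0 v0 w0 lw ls lr hdbl C10 C20 hQ hR.
pose s x := (u x)^-1; pose r x := v x * w x ^+ 2.
have hs : admissible s.
  by split; [exact: locally_integrable_dintegrable|move=> x; rewrite invr_gt0].
have hr : admissible r.
  split; first exact: locally_integrable_dintegrable.
  by move=> x; rewrite mulr_gt0// exprn_gt0.
have hw : admissible w by split; first exact: locally_integrable_dintegrable.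
have mw : measurable_fun [set: R] w by case: hw => -[].
have us : u = dual s by apply/funext => x; rewrite /dual /s invrK.
have cQ : carleson_bounded s r w by exact: carleson_bounded_of_esum hQ.
have cR : carleson_bounded r s w by exact: carleson_bounded_of_esum hR.
have hD := doubling_constant hw hdbl.
have mvV : measurable_fun [set: R] (fun x => (v x)^-1) by exact: measurable_funV.
have E1 : bounded_L2 (fun x => u x * w x ^+ 2) r (square_fun w) <-> jump_bounded s r w.
  rewrite -wdiff_jump_bounded//; apply: bounded_square_fun => //.
    by apply: measurable_funM => //; exact: measurable_funX.
  by move=> x; rewrite mulrC us.
have E2 : bounded_L2 (fun x => (v x)^-1) s (square_fun w) <-> jump_bounded r s w.
  rewrite -wdiff_jump_bounded//; apply: bounded_square_fun => //.
  move=> x; rewrite /dual /r; have wx := w0 x; have vx := v0 x.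
  by field; rewrite !gt_eqF.
have lamE I : lambda_coef u v w I = 4 * `|jump (mass s) I * jump (mass r) I|
    * dlen I ^+ 2 / (mass s I * mass r I * mass w I).
  have l0 := @dlen_gt0 R I; have s0 := mass_gt0 I hs.1 hs.2.
  have r0 := mass_gt0 I hr.1 hr.2; have ww := mass_gt0 I hw.1 hw.2.
  have ll : dlen (lhalf I) = dlen I / 2 by rewrite (@dlen_half _ I (lhalf I))//; field.
  have lr' : dlen (rhalf I) = dlen I / 2 by rewrite (@dlen_half _ I (rhalf I))//; field.
  have DE g : `|Delta g I| = `|jump (mass g) I| * 2 / dlen I.
    rewrite /Delta !avgE ll lr' /jump -mulrBl normrM.
    rewrite (ger0_norm (_ : 0 <= (dlen I / 2)^-1)) ?invr_ge0 ?divr_ge0 ?(ltW l0)//.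
    by field; rewrite gt_eqF.
  rewrite /lambda_coef !DE -/s -/r !avgE normrM.
  by field; rewrite !gt_eqF.
rewrite -/r -/s.
have -> : haar_mult_unif_bounded u v w <-> sign_bounded s r w.
  by rewrite us; apply: haar_mult_unif_boundedP.
have E3 : bounded_L2 u v (pos_op w (lambda_coef u v w)) <-> pos_bounded s r w.
  by rewrite [in bounded_L2 u]us; apply: bounded_pos_op.
rewrite sign_boundedP//; split=> -[].
  by move=> /E1 h1 /E2 h2 /E3 h3.
by move=> /E1 h1 /E2 h2 /E3 h3.
Qed.

End PositiveWeights.

(** * Changing weights on null sets *)

Section AlmostEverywhere.
Variable R : realType.
Local Notation mu := (@lebesgue_measure R).
Local Notation dint := (@dint R).
Implicit Types (u v w f g : R -> R) (F G : R -> \bar R) (I J : dyadic).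

(* Weights are only positive almost everywhere; changing them on a null set
   affects neither side of the equivalence. *)
Definition same_weight u v := [/\ measurable_fun [set: R] u,
  measurable_fun [set: R] v & {ae mu, forall x, u x = v x}].

Lemma same_weight_sym u v : same_weight u v -> same_weight v u.
Proof.
move=> [mu1 mv e]; split=> //.
exact: (@filterS _ (almost_everywhere mu) _ _ _ _ e).
Qed.

Lemma same_weight_Rintegral u v (D : set R) : measurable (D : set (measurableTypeR R)) ->
  same_weight u v -> \int[mu]_(x in D) u x = \int[mu]_(x in D) v x.
Proof.
move=> mD [mu1 mv e]; congr fine; apply: ae_eq_integral => //.
- by apply/measurable_EFinP; exact: measurable_funS mu1.
- by apply/measurable_EFinP; exact: measurable_funS mv.
- by apply: (@filterS _ (almost_everywhere mu) _ _ _ _ e) => x ->.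
Qed.

Lemma same_weight_avg u v : same_weight u v -> avg u = avg v.
Proof.
move=> h; apply/funext => I; rewrite /avg; congr (_ * _).
exact: same_weight_Rintegral (measurable_dint I) h.
Qed.

Lemma same_weight_locally_integrable u v : same_weight u v ->
  locally_integrable [set: R] u -> locally_integrable [set: R] v.
Proof.
move=> [mu1 mv e] [_ oT hK]; split => // K KT cK.
have mK := compact_measurable cK.
rewrite (_ : (\int[mu]_(x in K) `|v x|%:E = \int[mu]_(x in K) `|u x|%:E)%E).
  exact: hK.
apply: ae_eq_integral => //.
- by apply/measurable_EFinP; apply: measurableT_comp => //; exact: measurable_funS mv.
- by apply/measurable_EFinP; apply: measurableT_comp => //; exact: measurable_funS mu1.
- by apply: (@filterS _ (almost_everywhere mu) _ _ _ _ e) => x ->.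
Qed.

Lemma same_weight_L2norm u v F G : same_weight u v ->
  measurable_fun [set: R] F -> measurable_fun [set: R] G ->
  {ae mu, forall x, F x = G x} -> L2norm u F = L2norm v G.
Proof.
move=> [mu1 mv e] mF mG FG; rewrite /L2norm; congr (_ `^ _)%E.
have mS H : measurable_fun [set: R] H ->
    measurable_fun [set: R] (fun x => `|H x| ^+ 2)%E.
  move=> mH; under eq_fun do rewrite expe2.
  by apply: emeasurable_funM; exact: measurableT_comp.
apply: ae_eq_integral => //.
- by apply: emeasurable_funM; [exact: mS|exact/measurable_EFinP].
- by apply: emeasurable_funM; [exact: mS|exact/measurable_EFinP].
- by apply: (@filterS2 _ (almost_everywhere mu) _ _ _ _ _ e FG) => x -> ->.
Qed.

Lemma same_weight_inL2 u v f : same_weight u v -> inL2 u f -> inL2 v f.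
Proof.
move=> h [mf]; rewrite (same_weight_L2norm h (G := EFin \o f))//.
- by exact/measurable_EFinP.
- by exact/measurable_EFinP.
- exact: aeW.
Qed.

Lemma same_weight_bounded u u' v v' (T T' : (R -> R) -> R -> \bar R) :
  same_weight u u' -> same_weight v v' ->
  (forall f, measurable_fun [set: R] f ->
     [/\ measurable_fun [set: R] (T f),
         measurable_fun [set: R] (T' f) &
         {ae mu, forall x, T f x = T' f x}]) ->
  bounded_L2 u v T -> bounded_L2 u' v' T'.
Proof.
move=> hu hv hT [C C0 h]; exists C => // f hf.
have hf' := same_weight_inL2 (same_weight_sym hu) hf.
have mf : measurable_fun [set: R] f by case: hf.
have [m1 m2 e] := hT f mf; have mE := (measurable_EFinP _ _).2 mf.
rewrite -(same_weight_L2norm hv m1 m2 e) -(same_weight_L2norm hu mE mE)//.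
  exact: h.
exact: aeW.
Qed.

(** The same sum g serves for both triples, because the partial sums agree almost everywhere. *)
Lemma same_weight_haar u u' v v' w w' :
  same_weight u u' -> same_weight v v' -> same_weight w w' ->
  haar_mult_unif_bounded u v w -> haar_mult_unif_bounded u' v' w'.
Proof.
move=> hu hv hw [C C0 h]; exists C => // eps heps f hf.
have hf' := same_weight_inL2 (same_weight_sym hu) hf.
have mf : measurable_fun [set: R] f by case: hf.
have mE := (measurable_EFinP _ _).2 mf.
have [g [mg lg] ng] := h eps heps f hf'.
have mgE := (measurable_EFinP _ _).2 mg.
exists g; last first.
  rewrite -(same_weight_L2norm hv mgE mgE); last exact: aeW.
  by rewrite -(same_weight_L2norm hu mE mE); last exact: aeW.
split=> //.
suff e : (fun A : {fset dyadic} => L2norm v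
      (fun x => (g x - \sum_(I <- A) haar_mult_term w eps f I x)%:E)) =
    (fun A : {fset dyadic} => L2norm v'
      (fun x => (g x - \sum_(I <- A) haar_mult_term w' eps f I x)%:E)).
  by rewrite -e.
have [mw mw' ew] := hw.
have mt k I : measurable_fun [set: R] k ->
    measurable_fun [set: R] (haar_mult_term k eps f I).
  move=> mk; rewrite /haar_mult_term; apply: measurable_funM.
    apply: measurable_funM; last exact: measurable_cst.
    apply: measurable_funM; first exact: measurable_cst.
    by apply: measurable_funM => //; exact: measurable_cst.
  apply: measurable_funM; first exact: measurable_cst.
  by apply: measurable_funB; exact: (measurable_indic (measurable_dint _)).
apply/funext => A; apply: same_weight_L2norm => //.
- apply/measurable_EFinP; apply: measurable_funB => //.
  by apply: measurable_sum => I; exact: mt.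
- apply/measurable_EFinP; apply: measurable_funB => //.
  by apply: measurable_sum => I; exact: mt.
- apply: (@filterS _ (almost_everywhere mu) _ _ _ _ ew) => x wx.
  congr (_ - _)%:E; apply: eq_bigr => I _.
  by rewrite /haar_mult_term wx (same_weight_avg hw).
Qed.

Lemma measurable_square_fun w f : measurable_fun [set: R] (square_fun w f).
Proof.
apply: (measurableT_comp (measurable_poweR _)).
apply: measurable_esum => [I x|I]; first by rewrite lee_fin mulr_ge0// sqr_ge0.
apply/measurable_EFinP; apply: measurable_funM; first exact: measurable_cst.
exact: (measurable_indic (measurable_dint I)).
Qed.

Lemma same_weight_square_fun w w' f : same_weight w w' ->
  measurable_fun [set: R] f -> square_fun w f = square_fun w' f.
Proof.
move=> hw mf; suff e : wavg w f = wavg w' f by rewrite /square_fun e.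
apply/funext => I; rewrite /wavg /wmeas (same_weight_Rintegral (measurable_dint I) hw).
congr (_ * _); apply: same_weight_Rintegral (measurable_dint I) _.
have [mw mw' e] := hw; split; [exact: measurable_funM|exact: measurable_funM|].
by apply: (@filterS _ (almost_everywhere mu) _ _ _ _ e) => x ->.
Qed.

Lemma same_weight_pos_op w w' lam f : same_weight w w' ->
  {ae mu, forall x, pos_op w lam f x = pos_op w' lam f x}.
Proof.
move=> [_ _ e]; apply: (@filterS _ (almost_everywhere mu) _ _ _ _ e) => x wx.
by rewrite /pos_op wx.
Qed.

Definition posify u x : R := if 0 < u x then u x else 1.

Lemma posify_gt0 u x : 0 < posify u x.
Proof. by rewrite /posify; case: ifP. Qed.

Lemma same_weight_posify u : weight u -> same_weight u (posify u).
Proof.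
move=> [u0 [mu1 _ _]]; split => //.
  apply: measurable_fun_ifT => //; first exact: measurable_fun_ltr.
- by apply: (@filterS _ (almost_everywhere mu) _ _ _ _ u0) => x; rewrite /posify => ->.
Qed.

End AlmostEverywhere.

Theorem theorem8 (R : realType) (u v w : R -> R) (C1 C2 : R)
  (hu : weight u) (hv : weight v) (hw : weight w)
  (hui : locally_integrable [set: R] (fun x => (u x)^-1))
  (hvw : locally_integrable [set: R] (fun x => v x * w x ^+ 2))
  (hdbl : dyadic_doubling w)
  (hC1 : 0 < C1) (hC2 : 0 < C2)
  (hQ : forall J : dyadic,
     (Qsum u v w J <= (C1 * avg (fun x => (u x)^-1) J)%:E)%E)
  (hR : forall J : dyadic,
     (Rsum u v w J <= (C2 * avg (fun x => (v x * w x ^+ 2)%R) J)%:E)%E) :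
  haar_mult_unif_bounded u v w <->
  [/\ bounded_L2 (fun x => u x * w x ^+ 2) (fun x => v x * w x ^+ 2)
        (square_fun w),
      bounded_L2 (fun x => (v x)^-1) (fun x => (u x)^-1) (square_fun w)
    & bounded_L2 u v (pos_op w (lambda_coef u v w))].
Proof.
pose u' := posify u; pose v' := posify v; pose w' := posify w.
have su : same_weight u u' := same_weight_posify hu.
have sv : same_weight v v' := same_weight_posify hv.
have sw : same_weight w w' := same_weight_posify hw.
have [mu1 mu' eu] := su; have [mv mv' ev] := sv; have [mw mw' ew] := sw.
have sui : same_weight (fun x => (u x)^-1) (fun x => (u' x)^-1).
  split; first by case: hui.
    exact: measurable_funV.
  by apply: (@filterS _ (almost_everywhere _) _ _ _ _ eu) => x ->.
have svi : same_weight (fun x => (v x)^-1) (fun x => (v' x)^-1).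
  split; [exact: measurable_funV|exact: measurable_funV|].
  by apply: (@filterS _ (almost_everywhere _) _ _ _ _ ev) => x ->.
have suw : same_weight (fun x => u x * w x ^+ 2) (fun x => u' x * w' x ^+ 2).
  split; [by apply: measurable_funM => //; exact: measurable_funX|
    by apply: measurable_funM => //; exact: measurable_funX|].
  by apply: (@filterS2 _ (almost_everywhere _) _ _ _ _ _ eu ew) => x -> ->.
have svw : same_weight (fun x => v x * w x ^+ 2) (fun x => v' x * w' x ^+ 2).
  split; [by apply: measurable_funM => //; exact: measurable_funX|
    by apply: measurable_funM => //; exact: measurable_funX|].
  by apply: (@filterS2 _ (almost_everywhere _) _ _ _ _ _ ev ew) => x -> ->.
have au := same_weight_avg sui; have avw := same_weight_avg svw.
have aw := same_weight_avg sw.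
have lamE : lambda_coef u v w = lambda_coef u' v' w'.
  by apply/funext => I; rewrite /lambda_coef /Delta au avw aw.
have P := @haar_multiplier_positive R u' v' w' C1 C2 mu' mv'
  (posify_gt0 u) (posify_gt0 v) (posify_gt0 w).
have {}P : haar_mult_unif_bounded u' v' w' <->
  [/\ bounded_L2 (fun x => u' x * w' x ^+ 2) (fun x => v' x * w' x ^+ 2) (square_fun w'),
      bounded_L2 (fun x => (v' x)^-1) (fun x => (u' x)^-1) (square_fun w')
    & bounded_L2 u' v' (pos_op w' (lambda_coef u' v' w'))].
  apply: P => //.
  - by apply: same_weight_locally_integrable sw _; case: hw.
  - exact: same_weight_locally_integrable sui hui.
  - exact: same_weight_locally_integrable svw hvw.
  - move: hdbl; rewrite /dyadic_doubling.
    have e I : wmeas w I = wmeas w' I.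
      exact: same_weight_Rintegral (measurable_dint I) sw.
    by under eq_fun do rewrite !e.
  - by move=> J; have := hQ J; rewrite /Qsum au avw aw.
  - by move=> J; have := hR J; rewrite /Rsum au avw aw.
have sq k k' f : same_weight k k' -> measurable_fun [set: R] f ->
   [/\ measurable_fun [set: R] (square_fun k f),
       measurable_fun [set: R] (square_fun k' f) &
       {ae @lebesgue_measure R, forall x, square_fun k f x = square_fun k' f x}].
  move=> hk mf; split; [exact: measurable_square_fun|
    exact: measurable_square_fun|].
  by rewrite (same_weight_square_fun hk mf); exact: aeW.
have po k k' lam f : same_weight k k' ->
   [/\ measurable_fun [set: R] (pos_op k lam f),
       measurable_fun [set: R] (pos_op k' lam f) &
       {ae @lebesgue_measure R, forall x, pos_op k lam f x = pos_op k' lam f x}].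
  move=> hk; have [mk mk' _] := hk; split.
  - exact: measurable_pos_op.
  - exact: measurable_pos_op.
  - exact: same_weight_pos_op.
have sw' := same_weight_sym sw.
split.
- move=> /(same_weight_haar su sv sw)/P[h1 h2 h3]; split.
  + apply: same_weight_bounded h1 => [||f mf]; [exact: same_weight_sym|exact: same_weight_sym|exact: sq].
  + apply: same_weight_bounded h2 => [||f mf]; [exact: same_weight_sym|exact: same_weight_sym|exact: sq].
  + by rewrite lamE; apply: same_weight_bounded h3 => [||f mf]; [exact: same_weight_sym|exact: same_weight_sym|exact: po].
- move=> [h1 h2 h3].
  apply: (same_weight_haar (same_weight_sym su) (same_weight_sym sv) sw').
  apply/P; split.
  + by apply: same_weight_bounded h1 => // f mf; exact: sq.
  + by apply: same_weight_bounded h2 => // f mf; exact: sq.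
  + by rewrite -lamE; apply: same_weight_bounded h3 => // f mf; exact: po.
Qed.
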